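(* Every tournament with minimum outdegree at least $6$ contains three pairwise vertex-disjoint (directed) cycles of pairwise different lengths. Moreover, the bound $6$ is sharp: there exists a tournament with minimum outdegree $5$ that does not contain three pairwise vertex-disjoint cycles of pairwise different lengths.
   Context: A tournament is an orientation of a finite complete graph (exactly one arc between every two distinct vertices). Cycles are directed cycles. *)

(* Defs.v *)
From mathcomp Require Import all_boot.
Set Implicit Arguments. Unset Strict Implicit. Unset Printing Implicit Defensive.

Definition tournament (T : finType) (e : rel T) : Prop :=
  (forall x, ~~ e x x) /\
  (forall x y, x != y -> (e x y || e y x) && ~~ (e x y && e y x)).

Definition outdeg (T : finType) (e : rel T) (x : T) : nat := #|[set y | e x y]|.

Definition min_outdeg_ge (T : finType) (e : rel T) (k : nat) : Prop :=
  forall x, k <= outdeg e x.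

Definition min_outdeg_eq (T : finType) (e : rel T) (k : nat) : Prop :=
  min_outdeg_ge e k /\ exists x, outdeg e x = k.

(* a directed cycle, given as the (nonempty, duplicate-free) sequence of its
   vertices v_0 ... v_{l-1} with arcs v_i -> v_{i+1} and v_{l-1} -> v_0;
   its length is size c *)
Definition dcycle (T : finType) (e : rel T) (c : seq T) : Prop :=
  [/\ 0 < size c, uniq c & cycle e c].

Definition three_disjoint_cycles_distinct_lengths (T : finType) (e : rel T) : Prop :=
  exists c1 c2 c3 : seq T,
    [/\ dcycle e c1, dcycle e c2, dcycle e c3,
        [/\ [disjoint c1 & c2], [disjoint c1 & c3] & [disjoint c2 & c3]] &
        [/\ size c1 != size c2, size c1 != size c3 & size c2 != size c3]].

(* Main.v *)
Require Import Defs.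
From mathcomp Require Import all_boot zify.
Set Implicit Arguments. Unset Strict Implicit. Unset Printing Implicit Defensive.

(** A strong tournament contains cycles of every length from 3 to its order, so
    it is enough to find three disjoint cycles of lengths 3, 4 and 5.

    Remove a triangle [A]. The rest has minimum outdegree at least 3; let [D] be
    its terminal strong component, which the remaining vertices [U] dominate.
    If [#|D| <= 8], counting arcs shows that almost all arcs between [D] and [A]
    go from [D] to [A] and that every vertex of [A] has out-neighbours in [U];
    the arcs [A -> U -> D -> A] then give the three cycles.

    If [#|D| >= 9], then [D] itself contains disjoint cycles of lengths 4 and 5.
    Let [S] be a minimal subset of [D] of minimum outdegree at least 3. Every
    vertex of [S] has an in-neighbour in [S] of outdegree exactly 3, and counting
    the arcs out of these gives [#|S| <= 10]. If [#|S| = 10], deleting a suitable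
    vertex leaves a strong tournament on 9 vertices with outdegrees at least 3,
    except for one which is at least 2. Otherwise [S] grows to a strong set of 9
    vertices inside [D], or the two cycles appear on the way. What remains is a
    finite question on 9 vertices, settled by a certified case split.

    The bound is sharp since a regular tournament on 11 vertices has fewer than
    3 + 4 + 5 vertices. *)

(** * Outdegrees and terminal components *)

Definition dout (T : finType) (e : rel T) (S : {set T}) (x : T) : nat :=
  #|[set y in S | e x y]|.

(** Strong connectivity by cuts: some arc leaves every nonempty proper subset. The proofs use it by
    choosing [X], so no paths have to be built. *)
Definition strong (T : finType) (e : rel T) (S : {set T}) : Prop :=
  forall X : {set T}, X \subset S -> X != set0 -> X != S ->
  exists x y, [/\ x \in X, y \in S :\: X & e x y].

Lemma tournament_irr (T : finType) (e : rel T) x : tournament e -> e x x = false.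
Proof. by case=> irr _; apply: negbTE. Qed.

Lemma tournament_neq (T : finType) (e : rel T) x y :
  tournament e -> e x y -> x != y.
Proof.
by move=> tour exy; apply: contraTneq exy => ->; rewrite tournament_irr.
Qed.

Lemma tournament_sym (T : finType) (e : rel T) x y :
  tournament e -> x != y -> e y x = ~~ e x y.
Proof. by case=> _ tot /tot; case: (e x y) (e y x) => [] []. Qed.

Lemma tournament_asym (T : finType) (e : rel T) x y :
  tournament e -> e x y -> e y x = false.
Proof.
by move=> tour exy; rewrite (@tournament_sym _ _ x) ?exy ?(tournament_neq tour).
Qed.

Lemma card_sep_sum (T : finType) (S : {set T}) (P : pred T) :
  #|[set y in S | P y]| = \sum_(y in S) P y.
Proof.
rewrite -sum1_card big_mkcond [RHS]big_mkcond /=; apply: eq_bigr => y _.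
by rewrite inE; case: (y \in S); case: (P y).
Qed.

Lemma sum_din_dout (T : finType) (e : rel T) (M S : {set T}) :
  \sum_(v in S) #|[set u in M | e u v]| = \sum_(u in M) dout e S u.
Proof.
under eq_bigr do rewrite card_sep_sum.
by rewrite exchange_big /=; apply: eq_bigr => u _; rewrite -card_sep_sum.
Qed.

Lemma dout_din (T : finType) (e : rel T) (S : {set T}) x :
  tournament e -> x \in S -> (dout e S x + #|[set y in S | e y x]|).+1 = #|S|.
Proof.
move=> tour xS; rewrite /dout (cardsD1 x S) xS -cardsUI.
rewrite (_ : _ :&: _ = set0) ?cards0 ?addn0; last first.
  apply/setP=> y; rewrite !inE.
  case xy: (e x y); last by rewrite !andbF.
  by rewrite (tournament_asym tour xy) !andbF.
rewrite add1n; congr _.+1; apply: eq_card => y; rewrite !inE -andb_orr andbC.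
case: eqVneq => [->|neq_yx]; first by rewrite (tournament_irr x tour).
by rewrite (@tournament_sym _ _ x y) ?orbN // eq_sym.
Qed.

(** There are [n (n - 1) / 2] arcs among [n] vertices; the additive form avoids truncated
    subtraction and division. *)
Lemma sum_dout (T : finType) (e : rel T) (S : {set T}) :
  tournament e -> 2 * \sum_(x in S) dout e S x + #|S| = #|S| * #|S|.
Proof.
move=> tour; rewrite -sum_nat_const mul2n -addnn.
rewrite -[in RHS](eq_bigr _ (fun x => dout_din tour (x := x))).
under [RHS]eq_bigr do rewrite -addn1.
by rewrite !big_split /= sum_din_dout sum1_card.
Qed.

Lemma closed_dout (T : finType) (e : rel T) (D S : {set T}) x :
    D \subset S -> (forall y z, y \in D -> z \in S :\: D -> ~~ e y z) ->
  x \in D -> dout e D x = dout e S x.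
Proof.
move=> sDS clD xD; apply: eq_card => y; rewrite !inE.
case yD: (y \in D); first by rewrite (subsetP sDS).
case: (boolP (y \in S)) => //= yS; apply/esym/negbTE/(clD x y xD).
by rewrite inE yD.
Qed.

(** Take a nonempty subset of least size that no arc of [S] leaves. A proper nonempty part with no
    arc to the rest of it would be a smaller such subset. *)
Lemma terminal_component (T : finType) (e : rel T) (S : {set T}) : S != set0 ->
  exists D : {set T}, [/\ D \subset S, D != set0, strong e D &
    forall x y, x \in D -> y \in S :\: D -> ~~ e x y].
Proof.
pose P (D : {set T}) := [&& D \subset S, D != set0 &
  [forall x in D, forall y in S :\: D, ~~ e x y]].
have closP D : P D -> forall x y, x \in D -> y \in S :\: D -> ~~ e x y.
  by case/and3P=> _ _ /forall_inP clD x y /clD /forall_inP; apply.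
move=> S0; have PS : P S.
  rewrite /P subxx S0; apply/forall_inP=> x _; apply/forall_inP=> y.
  by rewrite setDv inE.
case: (arg_minnP (fun D : {set T} => #|D|) PS) => D PD minD.
have /and3P[sDS D0 _] := PD; exists D; split=> //; last exact: closP.
move=> X sXD X0 neqXD.
case: (boolP [exists x in X, exists y in D :\: X, e x y]).
  by case/exists_inP=> x xX /exists_inP[y yDX exy]; exists x, y.
move=> noarc; have ltXD : #|X| < #|D|.
  by rewrite ltn_neqAle subset_leq_card // andbT; apply: contra neqXD => /eqP eqXD;
     rewrite eqEcard sXD eqXD /=.
rewrite ltnNge minD // in ltXD.
rewrite /P X0 (subset_trans sXD sDS); apply/forall_inP=> x xX.
apply/forall_inP=> y; rewrite inE => /andP[yX yS].
case: (boolP (y \in D)) => yD; last first.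
  by apply: (closP D PD); rewrite ?inE ?yD // (subsetP sXD).
apply: contra noarc => exy; apply/exists_inP; exists x => //.
by apply/exists_inP; exists y => //; rewrite inE yX.
Qed.

(** * Cycles in strong sets *)

(** Some arc [u -> v] leaves the out-neighbourhood of any vertex [x]; then [v] is not dominated by
    [x] and differs from it, so [v -> x]. *)
Lemma strong_triangle (T : finType) (e : rel T) (S : {set T}) :
    tournament e -> strong e S -> 1 < #|S| ->
  exists x y z, [/\ x \in S, y \in S & z \in S] /\ [/\ e x y, e y z & e z x].
Proof.
move=> tour strS S1; have [x xS] : exists x, x \in S by apply/card_gt0P; lia.
have [|||_ [y [/set1P-> + exy]]] := strS [set x].
- by rewrite sub1set.
- by rewrite -card_gt0 cards1.
- by apply: contraTneq S1 => <-; rewrite cards1.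
rewrite !inE => /andP[neq_yx yS].
have [|||u [v [+ +]]] := strS [set u in S | e x u].
- by apply/subsetP=> u; rewrite inE => /andP[].
- by apply/set0Pn; exists y; rewrite inE yS.
- by apply: contraTneq xS => <-; rewrite inE (tournament_irr x tour) andbF.
rewrite !inE => /andP[uS exu] /andP[] + vS; rewrite vS /= => nexv euv.
exists x, u, v; split=> //; split=> //.
rewrite (@tournament_sym _ _ x) //; apply: contraTneq exu => ->.
by rewrite (tournament_asym tour euv).
Qed.

(** If no outside vertex has both an in-neighbour and an out-neighbour in [S], the outside splits
    into the set [P] of vertices dominated by [S] and the vertices dominating [S]. Strength forces
    an arc from the former to the latter. *)
Lemma strong_extension (T : finType) (e : rel T) (D S : {set T}) :
    tournament e -> strong e D -> S \subset D -> S != set0 -> S != D ->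
  (exists x q y, [/\ q \in D :\: S, x \in S, y \in S, e x q & e q y]) \/
  (exists p q, [/\ p \in D :\: S, q \in D :\: S, e p q,
     forall x, x \in S -> e x p & forall x, x \in S -> e q x]).
Proof.
move=> tour strD sSD S0 neqSD.
have [s sS] := set0Pn _ S0.
pose P := [set p in D :\: S | [forall x in S, e x p]].
case: (boolP [exists q in D :\: S, [exists x in S, e x q] && [exists y in S, e q y]]).
  by case/exists_inP=> q qDS /andP[/exists_inP[x xS exq] /exists_inP[y yS eqy]];
     left; exists x, q, y.
move=> nomix; right.
have sepP q x : q \in D :\: S -> q \notin P -> x \in S -> e q x.
  move=> qDS qP xS; have neq_xq : x != q.
    by apply: contraTneq qDS => <-; rewrite inE xS.
  rewrite (@tournament_sym _ _ x) //; apply: contra nomix => exq.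
  apply/exists_inP; exists q => //; apply/andP; split.
    by apply/exists_inP; exists x.
  move: qP; rewrite inE qDS negb_forall_in => /exists_inP[y yS neyq].
  apply/exists_inP; exists y => //; rewrite (@tournament_sym _ _ y) //.
  by apply: contraTneq qDS => <-; rewrite inE yS.
have PP p x : p \in P -> x \in S -> e x p.
  by rewrite inE => /andP[_ /forall_inP]; apply.
have sPD : P \subset D.
  by apply/subsetP=> p; rewrite !inE => /andP[/andP[]].
have [||| p [q [pX qX epq]]] := strD (S :|: P).
- by rewrite subUset sSD.
- by apply/set0Pn; exists s; rewrite inE sS.
(* If [S :|: P] were all of [D], an arc leaving [P] would enter [S], although [S] dominates [P]. *)
- apply/negP=> /eqP eqD; have [|||p [q [pP qDP epq]]] := strD P => //.
  + have /subsetPn[p pD pS] : ~~ (D \subset S).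
      by apply: contra neqSD => sDS; rewrite eqEsubset sSD.
    by apply/set0Pn; exists p; move: pD; rewrite -eqD inE (negbTE pS).
  + apply: contraTneq (subsetP sSD s sS) => <-.
    by rewrite inE inE sS.
  have qS : q \in S.
    by move: qDP; rewrite inE => /andP[qP]; rewrite -{1}eqD in_setU (negbTE qP) orbF.
  by rewrite (tournament_asym tour (PP p q pP qS)) in epq.
move: qX; rewrite inE in_setU negb_or => /andP[/andP[qS qP] qD].
have qDS : q \in D :\: S by rewrite inE qS.
have pP : p \in P.
  move: pX; rewrite inE => /orP[pS|//].
  by rewrite (tournament_asym tour (sepP q p qDS qP pS)) in epq.
exists p, q; split=> //; first by move: pP; rewrite inE => /andP[].
- by move=> x; apply: PP.
- by move=> x; apply: sepP.
Qed.

(** Follow the cycle from [x]: the vertex [q] fits just before the first vertex that it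
    dominates. *)
Lemma cycle_insert (T : finType) (e : rel T) c x q y :
    tournament e -> cycle e c -> q \notin c ->
    x \in c -> y \in c -> e x q -> e q y ->
  exists c', perm_eq c' (q :: c) /\ cycle e c'.
Proof.
move=> tour + + /rot_to[i c1 def_c]; rewrite -(rot_cycle i).
rewrite -(mem_rot i c q) -(mem_rot i c y) def_c => cyc_c q_c + exq eqy.
rewrite inE => /orP[/eqP y_x|y_c1].
  by rewrite y_x (tournament_asym tour exq) in eqy.
have hasq : has (e q) c1 by apply/hasP; exists y.
have permq c' : perm_eq c' (q :: x :: c1) -> perm_eq c' (q :: c).
  by move/perm_trans->; rewrite // perm_cons -def_c perm_rot.
case: (split_find hasq) cyc_c q_c permq => z s1 s2 eqz noq.
rewrite /= rcons_path cat_path last_cat last_rcons rcons_path.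
rewrite -!andbA => /and4P[xs1 s1z zs2 s2x] q_c permq.
exists (q :: z :: s2 ++ x :: s1); split.
  apply: permq; rewrite perm_cons -cat_cons perm_catC /= perm_cons.
  by rewrite -cats1 -catA.
rewrite /= eqz rcons_path cat_path /= last_cat /= zs2 s2x xs1 /=.
(* The predecessor of [z] is [x] itself or a vertex that [q] does not dominate; in both cases it
   dominates [q]. *)
have [-> //|last_s1] : last x s1 = x \/ last x s1 \in s1.
  by case: (s1) => [|u s]; [left | right; rewrite /= mem_last].
rewrite (@tournament_sym _ _ q) //; first by apply: contra noq => ?; apply/hasP; exists (last x s1).
by apply: contraNneq q_c => ->; rewrite inE mem_cat mem_rcons inE last_s1 !orbT.
Qed.

(** The vertex [x] is replaced by the arc [p -> q], so the cycle grows by one. This serves the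
    second alternative of [strong_extension]. *)
Lemma cycle_detour (T : finType) (e : rel T) c x p q :
    cycle e (x :: c) -> c != [::] -> e p q ->
    (forall y, y \in c -> e y p) -> (forall y, y \in c -> e q y) ->
  cycle e (q :: rcons c p).
Proof.
case: c => // y c /= /andP[_ + _] epq cp qc.
rewrite qc ?mem_head //= !rcons_path last_rcons epq => /andP[-> _].
by rewrite cp // mem_last.
Qed.

(** Induction on the length, starting from a triangle: each alternative of [strong_extension] turns
    a cycle into one that is longer by one, by inserting a vertex or by a detour. *)
Lemma strong_cycles (T : finType) (e : rel T) (S : {set T}) l :
    tournament e -> strong e S -> 3 <= l <= #|S| ->
  exists c, [/\ size c = l, uniq c, cycle e c & {subset c <= S}].
Proof.
move=> tour strS; elim: l => // l IHl; rewrite ltnS leq_eqVlt => /andP[].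
case/predU1P=> [<- S3 | l3 ltlS].
  have [|x [y [z [[xS yS zS] [exy eyz ezx]]]]] := strong_triangle tour strS; first by lia.
  exists [:: x; y; z]; split; rewrite //= ?exy ?eyz ?ezx //; last first.
    by move=> u; rewrite !inE => /or3P[] /eqP->.
  by rewrite !inE negb_or (tournament_neq tour exy) (tournament_neq tour eyz)
             eq_sym (tournament_neq tour ezx).
have [|c [sz_c uniq_c cyc_c scS]] := IHl; first by rewrite l3 ltnW.
have card_c : #|[set x in c]| = l by rewrite cardsE (card_uniqP uniq_c).
have [|||[x [q [y [qSc xc yc exq eqy]]]]|[p [q [pSc qSc epq cp qc]]]] :=
    strong_extension tour strS (S := [set x in c]).
- by apply/subsetP=> x; rewrite inE; apply: scS.
- by rewrite -card_gt0 card_c; lia.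
- by apply: contraTneq ltlS => <-; rewrite card_c ltnn.
- move: qSc xc yc; rewrite !inE => /andP[qc qS] xc yc.
  have [c' [perm_c' cyc_c']] := cycle_insert tour cyc_c qc xc yc exq eqy.
  exists c'; split; rewrite ?(perm_size perm_c') ?(perm_uniq perm_c') //=.
  + by rewrite sz_c.
  + by rewrite qc.
  by move=> z; rewrite (perm_mem perm_c') inE => /predU1P[->|/scS].
move: pSc qSc; rewrite !inE => /andP[pc pS] /andP[qc' qS].
case: c => [|x c] in sz_c uniq_c cyc_c scS card_c cp qc pc qc' *; first by rewrite -sz_c in l3.
exists (q :: rcons c p); split.
- by rewrite /= size_rcons -sz_c.
- move: uniq_c pc qc'; rewrite /= !inE !negb_or rcons_uniq mem_rcons inE negb_or.
  move=> /andP[_ ->] /andP[_ ->] /andP[_ ->]; rewrite !andbT eq_sym.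
  exact: tournament_neq tour epq.
- apply: cycle_detour cyc_c _ epq _ _.
  + by rewrite -size_eq0; move: sz_c l3 => /= <-; case: (size c).
  + by move=> y yc; apply: cp; rewrite !inE yc orbT.
  + by move=> y yc; apply: qc; rewrite !inE yc orbT.
- move=> y; rewrite inE mem_rcons inE => /or3P[/eqP->|/eqP->|yc] //.
  by apply: scS; rewrite inE yc orbT.
Qed.

Lemma strong_add (T : finType) (e : rel T) (S : {set T}) x q y :
    strong e S -> x \in S -> y \in S -> e x q -> e q y ->
  strong e (q |: S).
Proof.
move=> strS xS yS exq eqy; have [qS|qS] := boolP (q \in S).
  by rewrite (setUidPr _) ?sub1set.
move=> X sX X0 neqX; case: (eqVneq (X :\ q) S) => [XqS | neqXqS].
  have qX : q \notin X.
    by apply: contra neqX => qX; rewrite -XqS setD1K.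
  exists x, q; split=> //; last by rewrite !inE eqxx qX.
  by have := xS; rewrite -XqS inE => /andP[].
have sXqS : X :\ q \subset S by rewrite subDset.
case: (eqVneq (X :\ q) set0) => [Xq0 | Xq0].
  have X1 : X = [set q].
    have [z zX] := set0Pn _ X0.
    have sX1 : X \subset [set q] by rewrite -setD_eq0 Xq0.
    by apply/eqP; rewrite eqEsubset sX1 sub1set -(set1P (subsetP sX1 z zX)).
  exists q, y; split=> //; rewrite X1 ?set11 // !inE yS orbT andbT.
  by apply: contraNneq qS => <-.
have [u [v [uX vX euv]]] := strS _ sXqS Xq0 neqXqS.
exists u, v; split=> //; first by move: uX; rewrite inE => /andP[].
move: vX; rewrite !inE negb_and negbK => /andP[/orP[/eqP v_q|->] vS].
  by rewrite -v_q vS in qS.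
by rewrite vS orbT.
Qed.

(** The parts are joined cyclically, [Y -> p -> q -> Y], so an arc leaving [X] is found at a
    transition where [X] stops containing the next part. *)
Lemma strong_return (T : finType) (e : rel T) (Y : {set T}) p q :
    Y != set0 -> e p q ->
    (forall y, y \in Y -> e y p) -> (forall y, y \in Y -> e q y) ->
  strong e (p |: (q |: Y)).
Proof.
move=> Y0 epq Yp qY X sX X0 neqX; have [z zY] := set0Pn _ Y0.
have memX u : u \in X -> [\/ u = p, u = q | u \in Y].
  by move/(subsetP sX); rewrite !inE => /or3P[/eqP|/eqP|]; [constructor 1|constructor 2|constructor 3].
case: (boolP (p \in X)) => pX; last first.
  case: (boolP [exists y in Y, y \in X]) => [/exists_inP[y yY yX]|noY].
    by exists y, p; split; rewrite ?Yp // !inE pX eqxx.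
  have qX : q \in X.
    have [u uX] := set0Pn _ X0; case: (memX u uX) => [u_p|<- //|uY].
      by rewrite -u_p uX in pX.
    by case/negP: noY; apply/exists_inP; exists u.
  exists q, z; split; rewrite ?qY // !inE zY !orbT andbT.
  by apply: contra noY => zX; apply/exists_inP; exists z.
case: (boolP (q \in X)) => qX; last first.
  by exists p, q; split; rewrite // !inE qX eqxx orbT.
case: (boolP [exists y in Y, y \notin X]) => [/exists_inP[y yY yX]|noY].
  by exists q, y; split; rewrite ?qY // !inE yX yY !orbT.
case/negP: neqX; rewrite eqEsubset sX !subUset !sub1set pX qX /=.
apply/subsetP=> y yY; apply: contraNT noY => yX.
by apply/exists_inP; exists y.
Qed.

(** * Nine vertices *)

(* Unlike [has], this stops at the first success under call-by-value. *)
Fixpoint any (A : Type) (P : A -> bool) (s : seq A) : bool :=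
  if s is x :: s' then if P x then true else any P s' else false.

Definition arc (K : seq (seq bool)) (i j : nat) : bool := nth false (nth [::] K i) j.

Definition add_arc (K : seq (seq bool)) (i j : nat) : seq (seq bool) :=
  set_nth [::] K i (set_nth false (nth [::] K i) j true).

(* Searches for a path of [k] further vertices from [x] inside [av] whose last
   vertex, together with the unused part of [av], satisfies [ok]. *)
Fixpoint walk (K : seq (seq bool)) (k x : nat) (av : seq nat)
    (ok : nat -> seq nat -> bool) : bool :=
  if k is k'.+1 then
    any (fun y => if arc K x y then walk K k' y (rem y av) ok else false) av
  else ok x av.

(** The 4-cycle is tried from every start and closed after 3 further vertices. The 5-cycle must use
    all five remaining vertices, so it may start at the first of them. *)
Definition has_4_5_cycles (K : seq (seq bool)) : bool :=
  any (fun x => walk K 3 x (rem x (iota 0 9)) (fun z av =>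
    if arc K z x then
      if av is y :: av' then walk K 4 y av' (fun w _ => arc K w y) else false
    else false)) (iota 0 9).

(* A bound [(v, A, m)] says that [v] has at most [m] in-neighbours in [A]; bounds
   on indegrees are used because they can be violated by partial information. *)
Definition overloaded (K : seq (seq bool)) (b : nat * seq nat * nat) : bool :=
  let: (v, A, m) := b in m < count (fun u => arc K u v) A.

(* [K] holds the arcs known so far among the vertices 0, ..., 8. Each entry
   [10 * i + j] of [arcs] splits on the orientation of the pair [i], [j]; the
   entries are consumed in depth-first order and the unread ones are returned. *)
Fixpoint refute (bounds : seq (nat * seq nat * nat)) (d : nat)
    (arcs : seq nat) (K : seq (seq bool)) : option (seq nat) :=
  if d is d'.+1 then
    if any (overloaded K) bounds then Some arcs else
    if has_4_5_cycles K then Some arcs else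
    if arcs is a :: arcs' then
      let: (i, j) := edivn a 10 in
      if [&& i < 9, j < 9 & i != j] then
        if refute bounds d' arcs' (add_arc K i j) is Some arcs'' then
          refute bounds d' arcs'' (add_arc K j i)
        else None
      else None
    else None
  else None.

(** The initial knowledge: vertices are numbered along a Hamiltonian cycle. *)
Definition cycle9 : seq (seq bool) :=
  [seq [seq j == i.+1 %% 9 | j <- iota 0 9] | i <- iota 0 9].

(** Outdegree at least 3 among [size A] vertices means indegree at most [size A - 1 - 3]. *)
Definition core_bounds (A : seq nat) : seq (nat * seq nat * nat) :=
  [seq (v, A, size A - 4) | v <- A].

(** Vertex 0 is the defective one: outdegree 2 among nine vertices allows indegree 6, outdegree 3
    allows 5. *)
Definition one_defect_bounds : seq (nat * seq nat * nat) :=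
  [seq (v, iota 0 9, if v == 0 then 6 else 5) | v <- iota 0 9].

(* Splitting pairs found by a lookahead search with unit propagation. *)
Definition arcs_one_defect : seq nat :=
  [:: 3; 4; 5; 41; 6; 51; 13; 25; 48; 71; 62; 72; 63; 16; 46; 53; 42; 73; 74;
   7; 81; 82; 83; 57; 2; 47; 37; 7; 81; 42; 28; 16; 46; 26; 36; 27; 58; 35;
   42; 73; 38; 17; 57; 35; 42; 28; 37; 63; 38; 24; 53; 17; 28; 37; 38; 20; 63;
   74; 62; 57; 47; 24; 37; 28; 38; 53; 20; 27; 62; 63; 64; 57; 16; 17; 18; 2;
   27; 37; 28; 42; 62; 38; 53; 63; 47; 64; 48; 42; 36; 7; 27; 37; 28; 53; 38;
   42; 52; 53; 75; 85; 16; 62; 71; 72; 63; 73; 7; 81; 82; 83; 46; 47; 36; 26;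
   17; 27; 18; 37; 28; 38; 20; 46; 47; 28; 73; 81; 16; 52; 17; 62; 27; 63; 38;
   74; 7; 57; 64; 53; 15; 31; 47; 53; 48; 24; 63; 51; 83; 74; 84; 13; 83; 2;
   74; 48; 31; 62; 35; 2; 24; 31; 25; 26; 17; 7; 15; 72; 35; 36; 37; 27; 81;
   20; 31; 61; 71; 52; 62; 51; 63; 38; 42; 53; 47; 64; 48; 47; 15; 16; 18; 25;
   35; 36; 13; 17; 38; 13; 53; 63; 48; 24; 20; 52; 51; 62; 64; 57; 17; 42; 18;
   64; 84; 20; 70; 15; 61; 25; 26; 81; 28; 73; 15; 16; 52; 38; 74; 68; 71; 72;
   7; 63; 48; 71; 63; 6; 46; 31; 41; 42; 72; 7; 35; 46; 41; 72; 63; 24; 24;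
   71; 75; 36; 6; 64; 35; 84; 75; 83; 71; 74; 7; 27; 61; 25; 13; 70; 14; 15;
   6; 17; 17; 37; 68; 14; 15; 6; 7; 81; 2; 24; 25; 28; 36; 14; 15; 6; 24; 58;
   20; 7; 52; 72; 18; 27; 2; 42; 52; 48; 13; 53; 38; 18; 16; 41; 51; 38; 53;
   46; 18; 7; 38; 13; 53; 41; 42; 47; 64; 15; 85; 17; 62; 25; 28; 73; 27; 63;
   7; 47; 31; 61; 81; 53; 41; 42; 51; 38; 83; 74; 61; 57; 64; 6; 81; 53; 48;
   61; 63; 14; 5; 18; 13; 14; 5; 15; 6; 61; 70; 81; 72; 63; 24; 53; 46; 16; 6;
   72; 81; 63; 64; 74; 15; 24; 86; 75; 5; 7; 82; 37; 26; 16; 52; 27; 48; 38;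
   20; 18; 50; 31; 41; 15; 6; 7; 42; 82; 35; 25; 47; 38; 7; 48; 37; 28; 13;
   20; 6; 14; 5; 51; 18; 6; 51; 41; 31; 18; 2; 42; 72; 70; 82; 35; 63; 5; 37;
   27; 81; 7; 82; 63; 73; 24; 15; 74; 84; 38; 64; 5; 14; 31; 2; 75; 68; 24;
   37; 28; 2; 18; 13; 7; 36; 53; 38; 41; 51; 36; 7; 38; 35; 2; 82; 15; 73; 14;
   5; 31; 7; 81; 84; 38; 68; 84; 47; 58; 5; 41; 25; 27; 63; 17; 62; 7; 37; 61;
   28; 24; 31; 40; 15; 81; 83; 28; 31; 40; 15; 4; 68; 60; 51; 2; 83; 75; 62;
   16; 42; 53; 82; 18; 70; 37; 13; 42; 35; 6; 36; 4; 81; 61; 82; 7; 17; 2; 26;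
   37; 16; 86; 71; 6; 62; 63; 81; 72; 28; 7; 6; 51; 17; 62; 16; 52; 27; 63;
   46; 53; 42; 73; 7; 81; 82; 38; 13; 4; 63; 14; 53; 46; 52; 72; 82; 63; 73;
   7; 83; 18; 4; 2; 64; 57; 2; 82; 73; 83; 18; 64; 72; 63; 4; 75; 7; 62; 16;
   68; 25; 83; 15; 82; 18; 73; 4; 2; 70; 63; 75; 17; 27; 13; 14; 61; 46; 28;
   18; 73; 4; 68; 7; 20; 13; 16; 14; 37; 14; 18; 68; 7; 16; 63; 64; 2; 17; 40;
   13; 4; 13; 61; 2; 70; 71; 62; 27; 63; 64; 57; 46; 17; 36; 27; 13; 4; 75;
   16; 7; 20; 14; 16; 17; 62; 63; 64; 86; 7; 75; 4; 27; 14; 15; 13; 81; 28;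
   37; 83; 18; 4; 20; 13; 14; 15; 4; 35; 36; 27; 18; 86; 15; 28; 26; 2; 7; 31;
   42; 37; 26; 37; 28; 2; 7; 15; 31; 41; 42; 38; 15; 2; 70; 82; 63; 73; 14;
   72; 83; 18; 57; 86; 18; 31; 72; 38; 2; 13; 26; 27; 42; 82; 7; 35; 36; 37;
   41; 81; 37; 28; 7; 36; 27; 42; 62; 35; 70; 86; 83; 18; 31; 41; 72; 28; 40;
   41; 42; 64; 35; 51; 61; 52; 5; 62; 72; 63; 6; 71; 82; 73; 7; 81; 83; 57; 6;
   31; 51; 82; 73; 62; 70; 61; 71; 81; 52; 27; 26; 17; 37; 28; 15; 2; 36; 27;
   18; 5; 16; 7; 31; 25; 16; 7; 18; 5; 31; 36; 27; 25; 38; 38; 28; 18; 85; 86;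
   7; 5; 41; 61; 52; 72; 63; 2; 53; 40; 71; 60; 51; 42; 62; 73; 46; 51; 71;
   42; 62; 53; 40; 73; 60; 46; 36; 20; 16; 14; 24; 15; 6; 31; 71; 25; 26; 5;
   15; 6; 16; 26; 17; 31; 41; 27; 25; 2; 40; 42; 35; 36; 37].

Definition arcs_core8 : seq nat :=
  [:: 3; 4; 5; 41; 6; 51; 13; 25; 48; 71; 62; 72; 63; 16; 46; 53; 42; 73; 47;
   2; 47; 37; 7; 81; 42; 28; 16; 46; 26; 36; 27; 58; 35; 42; 73; 38; 17; 57;
   35; 42; 28; 37; 63; 38; 24; 53; 17; 28; 37; 38; 20; 63; 74; 62; 57; 47; 24;
   37; 28; 38; 53; 20; 27; 62; 63; 64; 57; 16; 17; 18; 2; 27; 37; 28; 42; 62;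
   38; 53; 63; 47; 64; 48; 42; 36; 7; 27; 37; 28; 62; 53; 38; 42; 52; 53; 75;
   85; 16; 62; 71; 72; 63; 37; 36; 26; 17; 27; 18; 37; 28; 38; 20; 46; 47; 28;
   73; 81; 38; 74; 48; 58; 72; 17; 2; 31; 24; 71; 62; 72; 31; 63; 47; 52; 53;
   48; 24; 37; 27; 81; 20; 31; 61; 71; 52; 62; 51; 63; 38; 42; 53; 46; 47; 47;
   15; 16; 18; 25; 42; 62; 13; 17; 38; 13; 53; 63; 48; 24; 20; 52; 51; 62; 64;
   16; 57; 17; 42; 18; 64; 84; 20; 70; 15; 61; 25; 26; 81; 28; 73; 15; 16; 52;
   36; 46; 41; 86; 71; 38; 24; 27; 41; 17; 7; 42; 31; 38; 60; 53; 46; 24; 71;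
   75; 27; 6; 14; 25; 35; 2; 36; 6; 64; 35; 84; 38; 71; 25; 31; 2; 16; 14; 24;
   36; 13; 70; 14; 15; 6; 17; 17; 37; 68; 14; 15; 6; 7; 81; 2; 24; 25; 28; 36;
   14; 15; 6; 24; 52; 72; 18; 27; 42; 52; 48; 13; 53; 38; 20; 18; 16; 41; 51;
   38; 53; 46; 85; 17; 62; 25; 28; 73; 27; 63; 47; 31; 81; 53; 41; 42; 51; 61;
   38; 61; 63; 14; 5; 18; 13; 14; 5; 15; 6; 61; 70; 81; 72; 63; 24; 53; 46;
   16; 6; 72; 81; 63; 64; 74; 15; 24; 37; 5; 28; 26; 16; 52; 27; 48; 38; 20;
   18; 50; 31; 41; 15; 6; 7; 42; 82; 35; 25; 47; 38; 7; 48; 37; 28; 13; 20; 6;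
   14; 5; 51; 18; 24; 37; 28; 72; 63; 14; 5; 15; 72; 82; 15; 6; 81; 7; 63; 73;
   38; 64; 5; 14; 31; 2; 74; 48; 84; 47; 58; 28; 18; 73; 38; 68; 57; 17; 27;
   64; 15; 6; 4; 5; 7; 13; 14; 40; 60; 50; 70; 41; 51; 42; 61; 52; 71; 62; 27;
   6; 51; 70; 5; 41; 61; 52; 4; 71; 62; 53; 72; 63; 37; 20; 31; 81; 24; 13;
   42; 53; 71; 62; 72; 63; 37; 61; 71; 52; 62; 13; 64; 72; 36; 15; 7; 86; 18;
   38; 25; 16; 14; 5; 31; 20; 71; 24; 26; 16; 38; 18; 4; 5; 68; 75; 64; 13;
   25; 17; 41; 2; 26; 41; 71; 2; 52; 62; 27; 25; 26; 17; 42; 72; 63; 4; 5; 40;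
   41; 42; 64; 35; 51; 61; 25; 6; 31; 51; 82; 73; 62; 70; 61; 71; 81; 52; 27;
   26; 17; 37; 28; 15; 2; 36; 13; 25; 16; 7; 5; 18; 16; 7; 18; 5; 31; 36; 38;
   28; 18; 85; 86; 7; 5; 41; 61; 52; 72; 63; 2; 53; 40; 71; 60; 51; 42; 62;
   73; 46; 51; 71; 42; 62; 53; 40; 73; 60; 46; 36; 20; 16; 14; 24; 15; 6; 31;
   71; 25; 26; 5; 15; 6; 16; 26; 17; 31; 41; 27; 42; 25].

(* The entry of index [p - 1] is for a core missing the vertices 0 and [p]. *)
Definition arcs_core7 : seq (seq nat) := [::
  [:: 3; 4; 5; 41; 6; 51; 13; 25; 48; 71; 62; 72; 63; 46; 53; 42; 73; 61; 47;
   16; 46; 26; 36; 27; 58; 35; 42; 73; 38; 17; 57; 35; 42; 28; 37; 63; 38; 24;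
   53; 17; 28; 37; 38; 20; 63; 74; 62; 57; 47; 24; 37; 28; 38; 53; 20; 27; 62;
   63; 46; 16; 17; 18; 2; 27; 37; 28; 42; 62; 38; 53; 63; 46; 47; 42; 36; 7;
   27; 37; 28; 62; 53; 38; 42; 52; 53; 75; 85; 16; 62; 71; 72; 63; 37; 36; 26;
   17; 27; 18; 37; 28; 38; 28; 73; 81; 27; 63; 47; 31; 53; 38; 71; 52; 62; 46;
   51; 24; 61; 52; 83; 74; 48; 15; 37; 47; 15; 16; 25; 35; 63; 81; 20; 24; 31;
   26; 38; 53; 63; 16; 52; 75; 26; 20; 31; 17; 81; 7; 24; 57; 25; 20; 48; 24;
   31; 62; 51; 27; 26; 81; 28; 73; 36; 46; 51; 86; 71; 52; 41; 38; 24; 27; 51;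
   17; 7; 42; 31; 61; 52; 41; 38; 60; 53; 46; 13; 70; 14; 15; 6; 17; 17; 37;
   68; 14; 15; 6; 7; 81; 2; 24; 25; 28; 27; 63; 14; 15; 6; 18; 42; 52; 48; 64;
   31; 18; 35; 63; 2; 14; 6; 15; 85; 28; 73; 38; 48; 68; 75; 27; 47; 31; 50;
   41; 60; 51; 61; 20; 71; 81; 24; 70; 25; 25; 13; 14; 5; 17; 62; 15; 6; 61;
   70; 81; 72; 63; 24; 53; 46; 26; 48; 20; 38; 46; 24; 72; 6; 15; 16; 7; 18;
   16; 17; 6; 62; 50; 41; 72; 81; 53; 51; 63; 37; 20; 7; 13; 24; 26; 42; 72;
   63; 51; 41; 50; 13; 6; 18; 84; 4; 14; 24; 28; 73; 38; 74; 27; 60; 51; 18;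
   25; 31; 16; 2; 6; 51; 70; 61; 71; 52; 62; 53; 72; 63; 50; 73; 46; 47; 37;
   35; 26; 17; 15; 63; 50; 81; 20; 7; 31; 16; 52; 27; 85; 28; 38; 68; 74; 75;
   27; 25; 5; 85; 28; 38; 68; 74; 75; 27; 37; 25; 16; 15; 6; 7; 17; 18; 42;
   26; 85; 28; 38; 68; 74; 75; 27; 37; 53; 14; 5; 24; 25];
  [:: 3; 4; 5; 41; 47; 28; 73; 17; 57; 63; 58; 15; 6; 2; 81; 24; 37; 60; 51;
   17; 57; 35; 85; 26; 31; 16; 2; 68; 71; 62; 57; 53; 70; 15; 2; 6; 13; 16;
   52; 36; 31; 27; 53; 62; 51; 60; 83; 70; 24; 17; 25; 35; 6; 31; 51; 17; 18;
   26; 20; 27; 36; 15; 7; 17; 31; 18; 38; 64; 84; 36; 16; 57; 52; 71; 2; 51;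
   62; 27; 27; 35; 13; 20; 18; 70; 42; 6; 15; 61; 17; 26; 81; 28; 73; 17; 47;
   31; 63; 53; 38; 24; 58; 48; 38; 60; 41; 51; 42; 61; 52; 35; 31; 36; 13; 70;
   14; 15; 6; 61; 17; 17; 37; 68; 14; 15; 6; 7; 31; 61; 81; 2; 24; 25; 28; 36;
   14; 15; 6; 31; 61; 81; 20; 7; 24; 52; 27; 27; 2; 18; 7; 31; 53; 41; 38; 16;
   31; 41; 51; 53; 38; 18; 7; 38; 13; 41; 51; 61; 42; 52; 53; 46; 47; 85; 38;
   18; 74; 48; 68; 75; 17; 25; 16; 31; 41; 2; 51; 42; 5; 60; 26; 17; 62; 70;
   18; 48; 68; 75; 60; 51; 37; 42; 28; 20; 61; 31; 50; 41; 25; 50; 41; 53; 24;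
   20; 31; 15; 26; 6; 20; 51; 81; 7; 52; 41; 72; 31; 16; 18; 7; 48; 68; 52;
   72; 50; 41; 16; 82; 53; 51; 2; 31; 24; 27; 2; 15; 31; 41; 61; 50; 52; 7;
   42; 82; 35; 16; 31; 41; 51; 42; 35; 36; 84; 4; 14; 18; 38; 58; 42; 72; 63;
   50; 74; 64; 16; 2; 24; 35; 72; 63; 73; 60; 51; 75; 61; 17; 2; 52; 62; 82;
   83; 70; 46; 26; 17; 6; 31; 7; 5; 51; 2; 27; 37; 5; 28; 15; 31; 7; 61; 2;
   25; 15; 6; 37; 28; 85; 38; 68; 7; 5; 16; 31; 71; 2; 25; 5; 85; 18; 38; 68;
   74; 75; 17; 31; 51; 2; 6; 61; 42; 25; 85; 18; 38; 68; 74; 75; 17; 37; 28;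
   64; 16; 5; 31; 41; 7; 15];
  [:: 3; 4; 5; 41; 6; 51; 57; 25; 85; 17; 62; 27; 61; 31; 36; 42; 28; 20; 70;
   37; 38; 46; 47; 26; 36; 27; 42; 82; 7; 13; 16; 18; 53; 37; 31; 16; 17; 18;
   36; 27; 42; 62; 82; 7; 37; 25; 31; 16; 17; 18; 85; 26; 42; 72; 2; 70; 82;
   36; 28; 73; 81; 48; 58; 68; 2; 61; 52; 15; 7; 13; 24; 31; 42; 51; 61; 25;
   37; 27; 81; 20; 31; 61; 71; 52; 62; 51; 63; 38; 42; 46; 53; 47; 42; 52; 62;
   13; 38; 47; 64; 16; 48; 17; 18; 48; 20; 53; 38; 64; 51; 16; 47; 26; 81; 28;
   73; 48; 58; 68; 16; 71; 2; 31; 41; 24; 13; 70; 14; 15; 6; 17; 17; 28; 73;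
   68; 42; 52; 72; 63; 14; 15; 85; 68; 18; 28; 48; 2; 15; 6; 27; 42; 52; 13;
   14; 5; 16; 31; 25; 16; 7; 42; 62; 50; 41; 51; 71; 6; 27; 75; 17; 62; 16;
   27; 26; 25; 13; 14; 5; 28; 42; 72; 15; 6; 7; 16; 16; 42; 72; 50; 41; 18;
   60; 31; 2; 70; 15; 84; 4; 14; 18; 28; 74; 58; 42; 64; 68; 16; 7; 2; 31; 5;
   15; 6; 52; 26; 17; 27; 27; 63; 17; 62; 53; 47; 38; 28; 50; 70; 61; 52; 46;
   51; 24; 58; 50; 70; 42; 73; 60; 51; 2; 25; 13; 35; 26; 17; 42; 52; 13; 6;
   82; 16; 51; 2; 36; 7; 5; 37; 5; 85; 18; 28; 68; 74; 75; 17; 15; 85; 18; 28;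
   68; 74; 75; 17; 27; 42; 52; 13; 62; 16; 41; 5; 6; 7; 15];
  [:: 3; 4; 5; 41; 6; 51; 13; 36; 16; 52; 26; 17; 48; 58; 35; 42; 37; 57; 17;
   52; 62; 35; 42; 37; 58; 25; 18; 20; 27; 62; 28; 27; 53; 73; 83; 24; 71; 25;
   16; 42; 52; 53; 75; 85; 16; 62; 71; 27; 36; 26; 17; 81; 7; 27; 28; 73; 81;
   38; 71; 62; 27; 37; 38; 27; 52; 62; 74; 15; 16; 13; 17; 42; 27; 18; 51; 61;
   52; 62; 53; 36; 26; 81; 28; 73; 38; 58; 68; 16; 71; 2; 41; 24; 13; 70; 14;
   15; 6; 17; 17; 28; 73; 68; 52; 72; 63; 14; 15; 6; 18; 85; 28; 18; 73; 38;
   68; 75; 17; 50; 41; 26; 51; 2; 6; 16; 70; 31; 24; 25; 13; 14; 5; 16; 70;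
   63; 26; 17; 60; 51; 18; 2; 42; 27; 47; 38; 6; 7; 26; 17; 51; 81; 2; 16; 62;
   71; 50; 6; 41; 72; 81; 53; 51; 63; 37; 20; 7; 13; 24; 84; 47; 58; 28; 18;
   73; 38; 68; 36; 16; 26; 17; 4; 31; 5; 14; 51; 2; 13; 27; 17; 7; 4; 5; 14;
   51; 2; 6; 25; 6; 51; 70; 5; 41; 61; 4; 71; 62; 53; 72; 36; 13; 42; 53; 71;
   62; 72; 36; 61; 71; 62; 13; 36; 20; 4; 41; 81; 24; 15; 83; 18; 68; 7; 4; 5;
   13; 16; 16; 62; 72; 63; 86; 18; 38; 70; 14; 5; 13; 51; 2; 4; 40; 41; 42;
   64; 16; 52; 13; 72; 63; 26; 51; 17; 2; 50; 7; 81; 28; 53; 15; 35; 7; 26;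
   17; 38; 13; 5; 6; 15; 38; 28; 18; 85; 86; 26; 70; 53; 61; 40; 71; 52; 36;
   2; 17; 52; 4; 13; 6; 51; 2; 7];
  [:: 3; 4; 5; 41; 24; 64; 74; 84; 16; 52; 71; 62; 27; 13; 25; 35; 37; 28; 57;
   27; 18; 70; 60; 31; 20; 51; 17; 31; 27; 63; 17; 62; 37; 28; 83; 60; 51; 47;
   58; 20; 61; 52; 51; 28; 62; 53; 38; 60; 73; 46; 62; 82; 73; 61; 52; 53; 71;
   63; 51; 46; 26; 81; 28; 73; 38; 48; 68; 71; 27; 13; 20; 60; 70; 14; 15; 13;
   70; 14; 15; 6; 17; 17; 28; 73; 68; 42; 72; 63; 14; 15; 85; 17; 62; 27; 63;
   37; 28; 47; 38; 70; 13; 61; 60; 15; 61; 52; 5; 41; 36; 42; 28; 20; 70; 13;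
   81; 41; 36; 42; 31; 28; 26; 27; 16; 63; 6; 51; 48; 5; 7; 41; 81; 24; 81; 7;
   82; 73; 24; 15; 38; 64; 47; 5; 2; 31; 14; 25; 42; 82; 73; 13; 61; 51; 41;
   18; 2; 50; 52; 53; 7; 6; 36; 38; 84; 28; 18; 73; 38; 74; 17; 27; 68; 4; 60;
   51; 2; 42; 25; 41; 5; 13; 85; 75; 64; 15; 6; 5; 7; 13; 14; 27; 63; 47; 17;
   37; 4; 15; 6; 58; 50; 31; 41; 2; 16; 7; 18; 85; 68; 5; 14; 18; 31; 61; 2;
   70; 60; 15; 64; 16; 25; 26; 14; 5; 13; 18; 38; 85; 86; 70; 50; 41; 61; 24;
   31; 60; 15; 42; 62; 14; 35; 5; 13; 16; 52; 75; 63; 83; 18; 2; 71; 46; 6; 4;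
   35; 71; 81; 38];
  [:: 3; 4; 5; 41; 47; 35; 61; 52; 15; 6; 62; 82; 63; 24; 37; 16; 52; 42; 84;
   71; 62; 27; 13; 2; 24; 31; 25; 26; 17; 81; 6; 7; 72; 28; 13; 42; 6; 28; 15;
   16; 17; 81; 20; 70; 25; 26; 24; 31; 38; 53; 20; 73; 61; 52; 15; 6; 81; 71;
   26; 26; 81; 28; 73; 38; 48; 58; 6; 41; 51; 24; 70; 31; 20; 61; 71; 25; 71;
   53; 15; 42; 14; 2; 13; 70; 14; 15; 6; 17; 17; 37; 68; 14; 15; 6; 7; 31; 81;
   2; 24; 25; 28; 27; 63; 14; 15; 6; 31; 18; 42; 52; 48; 14; 18; 31; 51; 35;
   85; 28; 18; 73; 38; 48; 2; 15; 6; 27; 14; 5; 31; 16; 7; 17; 31; 53; 24; 14;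
   5; 70; 15; 6; 61; 71; 25; 25; 13; 14; 5; 15; 26; 17; 81; 7; 16; 72; 60; 35;
   6; 71; 81; 62; 61; 70; 72; 63; 24; 53; 38; 2; 73; 46; 16; 42; 72; 63; 51;
   41; 50; 37; 17; 13; 6; 18; 84; 28; 18; 73; 38; 74; 58; 40; 60; 41; 51; 42;
   25; 31; 16; 38; 18; 74; 58; 40; 70; 41; 61; 42; 52; 15; 6; 5; 2; 35; 71;
   31; 26; 27; 63; 5; 41; 6; 51; 70; 61; 52; 35; 13; 20; 71; 24; 37; 13; 4;
   70; 15; 14; 24; 52; 4; 13; 46; 6; 7; 15; 17; 42; 18; 52; 13; 14; 5; 51; 70;
   61; 2; 71; 62; 35; 4];
  [:: 3; 4; 5; 41; 24; 64; 84; 16; 52; 71; 26; 37; 28; 35; 57; 27; 36; 13; 6;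
   7; 31; 16; 52; 53; 15; 6; 36; 17; 27; 28; 62; 2; 7; 37; 18; 38; 25; 37; 28;
   62; 47; 38; 53; 20; 15; 62; 82; 37; 26; 81; 28; 73; 36; 16; 24; 46; 51; 71;
   52; 13; 27; 51; 17; 7; 42; 31; 61; 52; 41; 35; 13; 70; 14; 15; 6; 61; 17;
   17; 28; 73; 68; 42; 52; 48; 14; 64; 31; 35; 6; 63; 15; 85; 17; 62; 16; 52;
   36; 42; 27; 28; 20; 70; 13; 14; 72; 63; 46; 52; 53; 15; 6; 81; 24; 26; 25;
   48; 38; 5; 41; 24; 31; 82; 15; 6; 53; 2; 46; 14; 24; 82; 15; 6; 37; 16; 42;
   82; 37; 84; 47; 58; 28; 18; 73; 38; 68; 36; 16; 26; 17; 4; 46; 5; 6; 7; 13;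
   27; 17; 7; 4; 5; 14; 51; 2; 6; 6; 51; 70; 5; 41; 61; 52; 35; 42; 31; 40;
   71; 26; 61; 71; 52; 62; 13; 35; 40; 14; 15; 38; 18; 68; 7; 4; 5; 16; 31;
   41; 25; 17; 2; 42; 26; 25; 16; 42; 7; 26; 40; 41; 42; 64; 15; 25; 31; 16;
   6; 27; 7; 18; 5; 82; 62; 35; 6; 35; 26; 17; 37; 28; 52; 31; 5; 7; 16; 18;
   2; 72; 36; 38; 28; 18; 85; 86; 26; 70; 53; 61; 40; 71; 52; 15; 2; 6; 13;
   17; 42; 52; 4; 13; 6; 35; 63; 50; 70; 20; 14];
  [:: 3; 4; 5; 41; 24; 64; 74; 16; 52; 26; 51; 31; 17; 28; 60; 35; 36; 25; 35;
   37; 13; 6; 15; 71; 62; 2; 27; 18; 28; 31; 16; 52; 53; 15; 6; 36; 17; 27;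
   62; 2; 28; 7; 37; 25; 37; 28; 53; 15; 6; 27; 62; 2; 7; 18; 36; 62; 72; 2;
   35; 63; 15; 6; 81; 37; 26; 81; 28; 73; 17; 27; 63; 51; 16; 14; 24; 25; 58;
   48; 38; 60; 41; 51; 42; 61; 52; 35; 31; 36; 13; 70; 14; 15; 6; 61; 17; 17;
   25; 48; 47; 61; 51; 31; 35; 42; 63; 14; 6; 18; 2; 27; 28; 38; 46; 14; 24;
   72; 36; 16; 42; 72; 63; 51; 41; 82; 13; 6; 81; 7; 37; 85; 17; 62; 16; 52;
   36; 42; 27; 28; 20; 70; 13; 14; 72; 63; 37; 28; 50; 41; 51; 7; 6; 81; 20;
   13; 24; 26; 25; 48; 38; 16; 27; 20; 18; 50; 31; 41; 15; 6; 7; 42; 82; 35;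
   7; 37; 28; 13; 20; 14; 16; 42; 72; 63; 51; 41; 37; 84; 47; 17; 62; 27; 37;
   28; 57; 60; 51; 70; 25; 13; 14; 37; 27; 57; 24; 63; 53; 14; 5; 15; 6; 31;
   2; 61; 25; 52; 13; 15; 6; 41; 5; 61; 2; 62; 82; 35; 28; 6; 51; 2; 4; 50;
   70; 41; 61; 18; 24; 31; 25; 15; 16; 5; 52; 83; 75; 27; 13; 4; 41; 2; 18;
   26; 7; 42; 35; 31; 41; 7; 53; 20; 4; 81; 24; 25; 26; 38; 28; 18; 85; 86;
   15; 70; 42; 14; 5; 61; 2; 31; 71; 25; 6; 7; 75; 26; 17; 20; 16; 31; 14; 5;
   16; 26; 17; 31; 41; 24; 52; 2; 4]].

(** The fuel 30 bounds the depth of the case tree; beside the nine arcs of the Hamiltonian cycle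
    only 27 of the 36 pairs are open. *)
Lemma refute_one_defect :
  isSome (refute one_defect_bounds 30 arcs_one_defect cycle9).
Proof. by vm_compute. Qed.

Lemma refute_core8 :
  isSome (refute (core_bounds (iota 1 8)) 30 arcs_core8 cycle9).
Proof. by vm_compute. Qed.

Lemma refute_core7 :
  all (fun p => isSome (refute (core_bounds (rem p (iota 1 8))) 30
                  (nth [::] arcs_core7 p.-1) cycle9)) (iota 1 8).
Proof. by vm_compute. Qed.

(** * Soundness of the case split *)

Lemma anyE (A : Type) (P : A -> bool) s : any P s = has P s.
Proof. by elim: s => //= x s ->; case: (P x). Qed.

Lemma arc_add_arc K i j u v :
  arc (add_arc K i j) u v -> arc K u v \/ (u = i /\ v = j).
Proof.
rewrite /arc /add_arc nth_set_nth /=; case: eqP => [->|_]; last by left.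
by rewrite nth_set_nth /=; case: eqP => [->|_]; [right | left].
Qed.

Lemma walkP K k x av ok : walk K k x av ok ->
  exists p av', [/\ size p = k, path (arc K) x p, perm_eq av (p ++ av') &
                    ok (last x p) av'].
Proof.
elim: k x av => [|k IHk] x av /=; first by exists [::], av.
rewrite anyE => /hasP[y y_av]; case: ifP => // xy /IHk[p [av' [<- yp av_p okp]]].
exists (y :: p), av'; split=> //=; first by rewrite xy.
by rewrite (perm_trans (perm_to_rem y_av)) // perm_cons.
Qed.

Definition splits_4_5 (E : rel nat) : Prop :=
  exists c4 c5, [/\ size c4 = 4, size c5 = 5, perm_eq (iota 0 9) (c4 ++ c5),
                    cycle E c4 & cycle E c5].

Lemma has_4_5_cyclesP K : has_4_5_cycles K -> splits_4_5 (arc K).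
Proof.
rewrite /has_4_5_cycles anyE => /hasP[x x_iota] /walkP[p [av [sz_p xp av_p]]].
case: ifP => // px; case: av av_p => // y av av_p.
case/walkP=> [q [av' [sz_q yq av_q qy]]].
have sz_av : size av = 4.
  have := perm_size av_p; rewrite size_rem // size_cat sz_p /= => -[].
  by case: (size av).
exists (x :: p), (y :: q); split; rewrite /= ?sz_p ?sz_q ?rcons_path ?xp ?yq //.
rewrite (perm_trans (perm_to_rem x_iota)) // perm_cons (perm_trans av_p) //.
have av'0 : av' = [::].
  by apply: size0nil; have := perm_size av_q; rewrite size_cat sz_q sz_av => -[].
by rewrite perm_cat2l perm_cons (perm_trans av_q) // av'0 cats0.
Qed.

(** The actual relation [E] selects one branch at every split and so reaches a leaf whose known arcs
    all belong to [E]. A violated bound there would be violated by [E] as well, so the leaf exhibits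
    the two cycles. *)
Lemma refute_sound bounds d arcs K rest (E : rel nat) :
    refute bounds d arcs K = Some rest ->
    (forall i j, i < 9 -> j < 9 -> i != j -> E i j || E j i) ->
    (forall v A m, (v, A, m) \in bounds -> count (fun u => E u v) A <= m) ->
    subrel (arc K) E ->
  splits_4_5 E.
Proof.
move=> + totE bndE; elim: d arcs K rest => //= d IHd arcs K rest.
rewrite anyE; case: ifP => [/hasP[[[v A] m] /bndE leEm ltmK] _ sKE | _].
  have := leq_trans ltmK (sub_count (fun u => sKE u v) A).
  by rewrite ltnNge leEm.
case: ifP => [/has_4_5_cyclesP[c4 [c5 [sz4 sz5 p45 cyc4 cyc5]]] _ sKE | _].
  by exists c4, c5; split=> //; [exact: sub_cycle cyc4 | exact: sub_cycle cyc5].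
case: arcs => // a arcs; case: (edivn a 10) => i j.
case: ifP => // /and3P[i9 j9 neq_ij].
case ref_ij: refute => [arcs'|] // ref_ji sKE.
have addE u v : E u v -> subrel (arc (add_arc K u v)) E.
  by move=> Euv x y /arc_add_arc[/sKE|[-> ->]].
case/orP: (totE _ _ i9 j9 neq_ij) => /addE; first exact: IHd ref_ij.
exact: IHd ref_ji.
Qed.

Definition disjoint_4_5_cycles (T : finType) (e : rel T) (D : {set T}) : Prop :=
  exists c4 c5, [/\ size c4 = 4, size c5 = 5, uniq (c4 ++ c5),
    {subset c4 ++ c5 <= D} & cycle e c4 /\ cycle e c5].

Lemma disjoint_4_5_cyclesS (T : finType) (e : rel T) (D D' : {set T}) :
  D \subset D' -> disjoint_4_5_cycles e D -> disjoint_4_5_cycles e D'.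
Proof.
move=> sDD' [c4 [c5 [sz4 sz5 uniq45 sub45 cyc45]]].
by exists c4, c5; split=> // z /sub45; apply: (subsetP sDD').
Qed.

Lemma cycle_nth (T : Type) (e : rel T) x0 c i :
  cycle e c -> i < size c -> e (nth x0 c i) (nth x0 c (i.+1 %% size c)).
Proof.
case: c => // x c /= /(pathP x0) cyc_c ltic.
have := cyc_c i; rewrite size_rcons => /(_ ltic).
rewrite -rcons_cons nth_rcons ltic nth_rcons; move: ltic; rewrite ltnS leq_eqVlt.
by case/predU1P=> [->|ltic]; rewrite ?ltnn ?eqxx ?modnn // ltic modn_small.
Qed.

Lemma arc_cycle9 i j : arc cycle9 i j -> i < 9 /\ j = i.+1 %% 9.
Proof.
rewrite /arc /cycle9; case: (ltnP i 9) => [lti9|le9i]; last first.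
  by rewrite [nth [::] _ _]nth_default ?nth_nil // size_map size_iota.
rewrite (nth_map 0) ?size_iota // nth_iota // add0n.
case: (ltnP j 9) => [ltj9|le9j]; last by rewrite nth_default // size_map size_iota.
by rewrite (nth_map 0) ?size_iota // nth_iota // add0n => /eqP.
Qed.

(** Index [i] stands for the vertex at position [i] of the spanning cycle [c], which makes [cycle9]
    true knowledge; the cycles found on indices are mapped back. *)
Lemma refute_cycles (T : finType) (e : rel T) x0 c bounds d arcs :
    tournament e -> uniq c -> size c = 9 -> cycle e c ->
    isSome (refute bounds d arcs cycle9) ->
    (forall v A m, (v, A, m) \in bounds ->
       count (fun u => e (nth x0 c u) (nth x0 c v)) A <= m) ->
  disjoint_4_5_cycles e [set x in c].
Proof.
move=> tour uniq_c sz_c cyc_c; case ref_c: refute => [rest|] // _ bnd.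
have [||c4 [c5 [sz4 sz5 p45 cyc4 cyc5]]] :=
    @refute_sound _ _ _ _ _ (fun i j => e (nth x0 c i) (nth x0 c j)) ref_c _ bnd.
- move=> i j lti ltj neq_ij; rewrite (@tournament_sym _ _ (nth x0 c i)) ?orbN //.
  by rewrite nth_uniq ?sz_c.
- by move=> i j /arc_cycle9[lti ->]; rewrite -sz_c cycle_nth // sz_c.
have perm_c : perm_eq (map (nth x0 c) (c4 ++ c5)) c.
  have {2}<- : map (nth x0 c) (iota 0 9) = c by rewrite -sz_c map_nth_iota0 ?take_size.
  by rewrite perm_map // perm_sym.
exists (map (nth x0 c) c4), (map (nth x0 c) c5); rewrite !size_map -map_cat.
split=> //; first by rewrite (perm_uniq perm_c).
  by move=> z; rewrite (perm_mem perm_c) inE.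
by rewrite !cycle_map.
Qed.

(** * Strong sets of nine vertices with large outdegrees *)

Lemma count_card (T : finType) (P : pred T) (S : {set T}) s :
  uniq s -> s =i S -> count P s = #|[set z in S | P z]|.
Proof.
move=> uniq_s eq_sS; rewrite -size_filter -(card_uniqP _) ?filter_uniq //.
by apply: eq_card => z; rewrite mem_filter !inE eq_sS andbC.
Qed.

(** Rotating the cycle puts a chosen vertex at index 0, where the certificates expect the
    distinguished vertex. *)
Lemma strong_spanning_cycle (T : finType) (e : rel T) (H : {set T}) x :
    tournament e -> strong e H -> 2 < #|H| -> x \in H ->
  exists c, [/\ size (x :: c) = #|H|, uniq (x :: c), cycle e (x :: c) & x :: c =i H].
Proof.
move=> tour strH H2 xH.
have [|c [sz_c uniq_c cyc_c scH]] := strong_cycles tour strH (l := #|H|).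
  by rewrite H2 leqnn.
have eq_cH : c =i H.
  have /eqP eqcH : [set z in c] == H.
    rewrite eqEcard cardsE (card_uniqP uniq_c) sz_c leqnn andbT.
    by apply/subsetP=> z; rewrite inE; apply: scH.
  by move=> z; rewrite -eqcH inE.
have /rot_to[i c' def_c] : x \in c by rewrite eq_cH.
exists c'; rewrite -def_c size_rot rot_uniq rot_cycle; split=> // z.
by rewrite mem_rot eq_cH.
Qed.

Lemma one_defect_cycles (T : finType) (e : rel T) (H : {set T}) u :
    tournament e -> strong e H -> #|H| = 9 -> u \in H -> 2 <= dout e H u ->
    (forall x, x \in H -> x != u -> 3 <= dout e H x) ->
  disjoint_4_5_cycles e H.
Proof.
move=> tour strH H9 uH dout_u doutH.
have [|c [sz_c uniq_c cyc_c eq_cH]] := strong_spanning_cycle tour strH _ uH.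
  by rewrite H9.
rewrite H9 in sz_c.
have <- : [set z in u :: c] = H by apply/setP=> z; rewrite inE eq_cH.
apply: (refute_cycles (x0 := u) tour uniq_c sz_c cyc_c refute_one_defect).
move=> _ _ _ /mapP[v v9 [-> -> ->]]; rewrite mem_iota add0n in v9.
set y := nth u (u :: c) v.
have yH : y \in H by rewrite -eq_cH mem_nth ?sz_c.
have -> : count (fun k => e (nth u (u :: c) k) y) (iota 0 9) = #|[set z in H | e z y]|.
  rewrite -(count_card _ uniq_c eq_cH).
  have {2}<- : map (nth u (u :: c)) (iota 0 9) = u :: c.
    by rewrite -sz_c map_nth_iota0 ?take_size.
  by rewrite count_map; apply: eq_count.
have dioy := dout_din tour yH.
case: eqP => [v0|/eqP v0]; first by have := dout_u; rewrite {1}/y v0 /= in dioy *; lia.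
have : 3 <= dout e H y; last by lia.
by apply: doutH => //; rewrite -[u]/(nth u (u :: c) 0) nth_uniq ?sz_c.
Qed.

(** Here [A] lists the positions of the core [S] on the spanning cycle, so that indegrees within [S]
    become counts over [A]. *)
Lemma core_index_cycles (T : finType) (e : rel T) (S : {set T}) x0 c A d arcs :
    tournament e -> uniq c -> size c = 9 -> cycle e c ->
    uniq A -> {subset A <= iota 0 9} ->
    S \subset [set x in c] -> (forall k, k < 9 -> (nth x0 c k \in S) = (k \in A)) ->
    (forall x, x \in S -> 3 <= dout e S x) ->
    isSome (refute (core_bounds A) d arcs cycle9) ->
  disjoint_4_5_cycles e [set x in c].
Proof.
move=> tour uniq_c sz_c cyc_c uniq_A sA9 sSc nthS doutS refA.
apply: (refute_cycles (x0 := x0) tour uniq_c sz_c cyc_c refA).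
have A9 k : k \in A -> k < 9 by move/sA9; rewrite mem_iota.
move=> _ _ _ /mapP[v vA [-> -> ->]]; set y := nth x0 c v.
have yS : y \in S by rewrite nthS ?A9.
have uniq_fA : uniq (map (nth x0 c) A).
  rewrite map_inj_in_uniq // => i j iA jA /eqP.
  by rewrite nth_uniq ?sz_c ?A9 // => /eqP.
have eq_fA : map (nth x0 c) A =i S.
  move=> z; apply/mapP/idP => [[k kA ->]|zS]; first by rewrite nthS ?A9.
  have zc : z \in c by have := subsetP sSc z zS; rewrite inE.
  exists (index z c); last by rewrite nth_index.
  by rewrite -nthS ?nth_index // -sz_c index_mem.
have cardS : #|S| = size A.
  by rewrite -(size_map (nth x0 c)) -(card_uniqP uniq_fA); apply/esym/eq_card.
rewrite -cardS.
have -> : count (fun k => e (nth x0 c k) y) A = #|[set z in S | e z y]|.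
  by rewrite -(count_card _ uniq_fA eq_fA) count_map; apply: eq_count.
by have := dout_din tour yS; have := doutS y yS; lia.
Qed.

(** A vertex outside the core is placed at index 0. A core of 8 vertices then occupies the indices 1
    to 8; a core of 7 misses one further index [p], and each of the eight values of [p] has its own
    certificate. *)
Lemma core_cycles (T : finType) (e : rel T) (H S : {set T}) :
    tournament e -> strong e H -> #|H| = 9 -> S \subset H -> 7 <= #|S| <= 8 ->
    (forall x, x \in S -> 3 <= dout e S x) ->
  disjoint_4_5_cycles e H.
Proof.
move=> tour strH H9 sSH S78 doutS.
have cardHS : #|H :\: S| = 9 - #|S| by rewrite cardsD (setIidPr sSH) H9.
have [x xHS] : exists x, x \in H :\: S by apply/card_gt0P; lia.
have /andP[xS xH] : (x \notin S) && (x \in H) by rewrite -in_setD.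
have [|c [sz_c uniq_c cyc_c eq_cH]] := strong_spanning_cycle tour strH _ xH.
  by rewrite H9.
rewrite H9 in sz_c.
have eqH : [set z in x :: c] = H by apply/setP=> z; rewrite inE eq_cH.
have cards := cardsD1 x (H :\: S); rewrite xHS cardHS in cards.
rewrite -eqH; case: (eqVneq #|S| 8) => [S8 | S7].
  apply: (core_index_cycles (x0 := x) (A := iota 1 8) tour uniq_c sz_c cyc_c _ _ _ _
            doutS refute_core8); rewrite ?eqH //.
    by move=> k; rewrite !mem_iota; lia.
  move=> [|k] ltk9; first by rewrite /= (negbTE xS).
  rewrite mem_iota [RHS](_ : _ = true); last by lia.
  have nthk : nth x (x :: c) k.+1 \in H by rewrite -eq_cH mem_nth ?sz_c.
  apply: contraTT isT => kS.
  have : nth x (x :: c) k.+1 \in (H :\: S) :\ x.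
    rewrite !inE kS nthk andbT -[x in _ == x]/(nth x (x :: c) 0).
    by rewrite nth_uniq ?sz_c.
  by rewrite (cards0_eq (A := _ :\ x)) ?inE //; lia.
have /cards1P[y def_y] : #|(H :\: S) :\ x| == 1 by lia.
have : y \in (H :\: S) :\ x by rewrite def_y set11.
rewrite !inE => /and3P[neq_yx yS yH].
have yc : y \in x :: c by rewrite eq_cH.
pose p := index y (x :: c).
have p9 : p < 9 by rewrite -sz_c index_mem.
have p0 : 0 < p by rewrite /p /= eq_sym (negbTE neq_yx).
have nthp : nth x (x :: c) p = y by rewrite nth_index.
have p18 : p \in iota 1 8 by rewrite mem_iota p0.
apply: (core_index_cycles (x0 := x) tour uniq_c sz_c cyc_c _ _ _ _
            doutS (allP refute_core7 p p18)); rewrite ?eqH //.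
- by rewrite rem_uniq // iota_uniq.
- by move=> k /mem_rem; rewrite !mem_iota => /andP[_ ->].
move=> k ltk9; rewrite mem_rem_uniq ?iota_uniq // inE mem_iota.
case: (eqVneq k p) => [-> | neq_kp]; first by rewrite nthp (negbTE yS).
case: k => [|k] in ltk9 neq_kp *; first by rewrite /= (negbTE xS).
rewrite [RHS](_ : _ = true) //.
have nthk : nth x (x :: c) k.+1 \in H by rewrite -eq_cH mem_nth ?sz_c.
apply: contraTT isT => kS.
have : nth x (x :: c) k.+1 \in (H :\: S) :\ x.
  rewrite !inE kS nthk andbT -[x in _ == x]/(nth x (x :: c) 0).
  by rewrite nth_uniq ?sz_c.
by rewrite def_y inE -nthp nth_uniq ?sz_c // (negbTE neq_kp).
Qed.

(** * Disjoint cycles of lengths 4 and 5 *)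

(** A subset of least size is strong because its terminal component keeps all outdegrees and hence
    equals it. *)
Lemma minimal_core (T : finType) (e : rel T) (S : {set T}) k :
    S != set0 -> (forall x, x \in S -> k <= dout e S x) ->
  exists D : {set T}, [/\ D \subset S, D != set0, strong e D,
    forall x, x \in D -> k <= dout e D x &
    forall X : {set T}, X \subset D -> X != set0 ->
      (forall x, x \in X -> k <= dout e X x) -> X = D].
Proof.
move=> S0 doutS.
pose P (D : {set T}) := [&& D \subset S, D != set0 &
  [forall x in D, k <= dout e D x]].
have PS : P S by rewrite /P subxx S0; apply/forall_inP.
case: (arg_minnP (fun D : {set T} => #|D|) PS) => D /and3P[sDS D0 /forall_inP doutD] minD.
have min_eq (X : {set T}) : X \subset D -> X != set0 ->
    (forall x, x \in X -> k <= dout e X x) -> X = D.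
  move=> sXD X0 doutX; apply/eqP; rewrite eqEcard sXD minD //.
  by rewrite /P (subset_trans sXD sDS) X0; apply/forall_inP.
exists D; split=> //; have [X [sXD X0 strX clX]] := terminal_component e D0.
rewrite -(min_eq X) // => x xX.
by rewrite (closed_dout sXD clX xX) doutD // (subsetP sXD).
Qed.

Lemma sum_dout_ge (T : finType) (e : rel T) (D : {set T}) k :
  (forall x, x \in D -> k <= dout e D x) -> k * #|D| <= \sum_(x in D) dout e D x.
Proof. by move=> doutD; rewrite mulnC -sum_nat_const leq_sum. Qed.

(** Counting arcs gives [3 n <= n (n - 1) / 2]. *)
Lemma dout3_card (T : finType) (e : rel T) (D : {set T}) :
    tournament e -> D != set0 -> (forall x, x \in D -> 3 <= dout e D x) ->
  7 <= #|D|.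
Proof.
move=> tour D0 /sum_dout_ge sum3; have := sum_dout D tour.
by move: D0; rewrite -card_gt0; nia.
Qed.

Lemma doutD1 (T : finType) (e : rel T) (D : {set T}) v x :
  v \in D -> dout e (D :\ v) x + e x v = dout e D x.
Proof.
move=> vD; rewrite /dout !card_sep_sum [RHS](bigD1 v) //= addnC; congr (_ + _).
by apply: eq_bigl => y; rewrite !inE andbC.
Qed.

(** Single vertices are added as long as [strong_extension] offers one. Otherwise
    [S -> p -> q -> S]: a 5-cycle inside [S] leaves two vertices [x -> y] of [S], and [x, y, p, q]
    is a 4-cycle. *)
Lemma strong_grow9 (T : finType) (e : rel T) (D S : {set T}) :
    tournament e -> strong e D -> 9 <= #|D| ->
    strong e S -> S \subset D -> 7 <= #|S| <= 9 ->
  disjoint_4_5_cycles e D \/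
  exists H : {set T}, [/\ H \subset D, S \subset H, strong e H & #|H| = 9].
Proof.
move=> tour strD D9; have [n] := ubnP (9 - #|S|).
elim: n S => // n IHn S ltn strS sSD S79.
case: (eqVneq #|S| 9) => [S9 | neqS9]; first by right; exists S.
case: (strong_extension tour strD sSD) => [||[x [q [y]]]|[p [q]]].
- by rewrite -card_gt0; lia.
- by apply: contraTneq D9 => <-; lia.
- rewrite inE => -[/andP[qS qD] xS yS exq eqy].
  have strSq := strong_add strS xS yS exq eqy.
  have cardSq : #|q |: S| = #|S|.+1 by rewrite cardsU1 qS.
  case: (IHn (q |: S)) => [|//||||[H [sHD sSH strH H9]]]; first by lia.
  + by rewrite subUset sub1set qD.
  + by lia.
  + by left.
  + right; exists H; split=> //.
    by apply: subset_trans sSH; apply: subsetUr.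
rewrite !inE => -[/andP[pS pD] /andP[qS qD] epq Sp qS']; left.
have [|c5 [sz5 uniq5 cyc5 sc5S]] := strong_cycles tour strS (l := 5); first by lia.
have card5 : #|[set z in c5]| = 5 by rewrite cardsE (card_uniqP uniq5).
have : 1 < #|S :\: [set z in c5]|.
  rewrite cardsD (setIidPr _) ?card5; first by lia.
  by apply/subsetP=> z; rewrite inE; apply: sc5S.
case/card_gt1P=> x [y [xSc ySc neq_xy]].
wlog exy : x y xSc ySc neq_xy / e x y.
  move=> wl; case exy: (e x y); first exact: (wl x y).
  by apply: (wl y x) => //; rewrite 1?eq_sym // (@tournament_sym _ _ x) ?exy.
move: xSc ySc; rewrite !inE => /andP[xc xS] /andP[yc yS].
have pc : p \notin c5 by apply: contra pS => /sc5S.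
have qc : q \notin c5 by apply: contra qS => /sc5S.
exists [:: x; y; p; q], c5; split=> //; last 1 first.
- by rewrite /= exy Sp // epq qS'.
- rewrite cat_uniq uniq5 andbT /= !inE !negb_or neq_xy (tournament_neq tour epq).
  rewrite !(tournament_neq tour (Sp _ _)) // ![_ == q]eq_sym.
  rewrite !(tournament_neq tour (qS' _ _)) //=.
  apply/hasPn=> z zc; have memc u : u \notin c5 -> z != u.
    by move=> uc; apply: contraNneq uc => <-.
  by rewrite !inE !negb_or !memc.
- move=> z; rewrite mem_cat !inE -!orbA => /or3P[/eqP->|/eqP->|].
  + exact: (subsetP sSD).
  + exact: (subsetP sSD).
  case/or3P=> [/eqP->|/eqP->|/sc5S] //; exact: (subsetP sSD).
Qed.

(** For use with [m] vertices of outdegree 3 and [r] others, [s'] and [s] being the numbers of arcs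
    from the former into each kind. The equations give [s = m (7 - m) / 2], and
    [m + s = m (9 - m) / 2] is at most 10. *)
Lemma cover_count m r s s' :
    s' + s = 3 * m -> 2 * s' + m = m * m ->
  (r <= s -> m + r <= 10) /\ (r * 2 <= s -> m + r <= 9).
Proof.
move=> def_s def_s'; have m7 : m <= 7 by nia.
by move: m m7 def_s def_s' => [|[|[|[|[|[|[|[|m]]]]]]]] //; lia.
Qed.

(** A proper terminal component [X] has at least [3 #|X| - 1] arcs, so at least 7 vertices. The at
    most two others receive no arc from [X], so each needs an in-neighbour among them, which takes
    at least three vertices. *)
Lemma one_defect_strong (T : finType) (e : rel T) (H : {set T}) u :
    tournament e -> #|H| = 9 -> 2 <= dout e H u ->
    (forall x, x \in H -> x != u -> 3 <= dout e H x) ->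
    (forall q, q \in H -> exists2 p, p \in H & e p q) ->
  strong e H.
Proof.
move=> tour H9 doutu doutx dinH.
have H0 : H != set0 by rewrite -card_gt0 H9.
have [X [sXH X0 strX clX]] := terminal_component e H0.
case: (eqVneq X H) => [<- // | neqX]; exfalso.
have sumu : \sum_(x in X) (x == u) <= 1.
  rewrite -card_sep_sum -(cards1 u) subset_leq_card //.
  by apply/subsetP=> x; rewrite !inE => /andP[].
have sumX : 3 * #|X| <= \sum_(x in X) dout e X x + \sum_(x in X) (x == u).
  rewrite -big_split mulnC -sum_nat_const leq_sum // => x xX.
  have xH := subsetP sXH x xX; rewrite (closed_dout sXH clX xX) /=.
  by case: eqVneq => [->|neq_xu]; rewrite ?addn1 // addn0 doutx.
pose Q := H :\: X.
have cardQ : #|Q| = 9 - #|X| by rewrite cardsD (setIidPr sXH) H9.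
have Q0 : 0 < #|Q|.
  rewrite card_gt0; apply: contra neqX; rewrite setD_eq0 => sHX.
  by rewrite eqEsubset sXH.
have sumQ : #|Q| <= \sum_(q in Q) dout e Q q.
  rewrite -sum_din_dout -sum1_card leq_sum // => q qQ.
  have [|p pH epq] := dinH q; first by move: qQ; rewrite inE => /andP[].
  apply/card_gt0P; exists p; rewrite inE epq andbT in_setD pH andbT.
  by apply: contraTN epq => pX; apply: clX.
rewrite -card_gt0 in X0.
move: (sum_dout X tour) (sum_dout Q tour) X0 Q0 cardQ sumu sumX sumQ.
by clear; nia.
Qed.

(** With [M] the vertices of outdegree 3, every vertex has an in-neighbour in [M]. Counting yields
    order 10 and a vertex [v] outside [M] with a single in-neighbour [u] in [M]; deleting [v] makes
    [u] the only defect. *)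
Lemma critical_core_cycles (T : finType) (e : rel T) (D : {set T}) :
    tournament e -> 10 <= #|D| ->
    (forall x, x \in D -> 3 <= dout e D x) ->
    (forall v, v \in D -> exists2 u, u \in D & e u v && (dout e D u == 3)) ->
  disjoint_4_5_cycles e D.
Proof.
move=> tour D10 doutD critD.
pose M := [set u in D | dout e D u == 3].
pose g v := #|[set u in M | e u v]|.
have sMD : M \subset D by apply/subsetP=> u; rewrite inE => /andP[].
have doutM u : u \in M -> dout e D u = 3 by rewrite inE => /andP[_ /eqP].
have gP v : v \in D -> exists2 u, u \in M & e u v.
  by case/critD=> u uD /andP[euv u3]; exists u; rewrite // inE uD.
have g_gt0 v : v \in D -> 1 <= g v.
  by case/gP=> u uM euv; apply/card_gt0P; exists u; rewrite inE uM.
have sumD : \sum_(v in D) g v = 3 * #|M|.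
  by rewrite sum_din_dout (eq_bigr _ doutM) sum_nat_const mulnC.
have sumM : 2 * \sum_(v in M) g v + #|M| = #|M| * #|M|.
  by rewrite sum_din_dout sum_dout.
have cardD : #|D| = #|M| + #|D :\: M|.
  by rewrite -(cardsID M D) (setIidPr sMD).
rewrite (big_setID M) /= (setIidPr sMD) in sumD.
have sum1 : #|D :\: M| <= \sum_(v in D :\: M) g v.
  by rewrite -sum1_card leq_sum // => v; rewrite inE => /andP[_ /g_gt0].
have D_eq10 : #|D| = 10.
  apply/eqP; rewrite eqn_leq D10 andbT cardD.
  by have [/(_ sum1) + _] := cover_count #|D :\: M| sumD sumM.
have [v vDM gv] : exists2 v, v \in D :\: M & g v = 1.
  case: (boolP [exists v in D :\: M, g v == 1]) => [/exists_inP[v ? /eqP]|no1].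
    by exists v.
  (* If every vertex outside [M] had two in-neighbours in [M], the second bound of [cover_count]
     would give at most 9 vertices. *)
  have sum2 : #|D :\: M| * 2 <= \sum_(v in D :\: M) g v.
    rewrite -sum_nat_const leq_sum // => v vDM.
    have : g v != 1 by apply: contra no1 => ?; apply/exists_inP; exists v.
    by move: vDM; rewrite inE => /andP[_ /g_gt0]; lia.
  by have [_ /(_ sum2)] := cover_count #|D :\: M| sumD sumM; rewrite -cardD leqNgt D10.
have {vDM sumD sumM sum1 cardD} /andP[vM vD] : (v \notin M) && (v \in D).
  by rewrite -in_setD.
have /cards1P[u def_u] : #|[set u in M | e u v]| == 1 by rewrite -/(g v) gv.
have : u \in [set u in M | e u v] by rewrite def_u set11.
rewrite inE => /andP[uM euv]; have uD := subsetP sMD u uM.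
have card9 : #|D :\ v| = 9 by have := cardsD1 v D; rewrite vD D_eq10; lia.
have uDv : u \in D :\ v by rewrite !inE uD (tournament_neq tour euv).
have doutu : 2 <= dout e (D :\ v) u.
  by have := doutD1 e u vD; rewrite (doutM u uM) euv; lia.
have doutx x : x \in D :\ v -> x != u -> 3 <= dout e (D :\ v) x.
  rewrite !inE => /andP[neq_xv xD] neq_xu.
  (* An in-neighbour of [v] other than [u] is outside [M], hence has outdegree at least 4 before the
     deletion. *)
  have := doutD1 e x vD; case exv: (e x v); last by rewrite addn0 => ->; apply: doutD.
  rewrite addn1 -ltnS => ->; rewrite ltn_neqAle doutD // andbT eq_sym.
  apply: contra neq_xu => x3.
  by have: x \in [set w in M | e w v] by [rewrite !inE xD x3]; rewrite def_u inE.
apply: disjoint_4_5_cyclesS (subsetDl D [set v]) _.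
suffices strDv : strong e (D :\ v) by apply: one_defect_cycles uDv doutu doutx.
(* Every vertex keeps an in-neighbour in [M], since the deleted [v] is not in [M]. *)
apply: one_defect_strong card9 doutu doutx _ => // q.
rewrite !inE => /andP[_ /gP[p pM epq]]; exists p => //.
by rewrite !inE (subsetP sMD) // andbT; apply: contraNneq vM => <-.
Qed.

Lemma strong_dout3_cycles (T : finType) (e : rel T) (D : {set T}) :
    tournament e -> strong e D -> 9 <= #|D| ->
    (forall x, x \in D -> 3 <= dout e D x) ->
  disjoint_4_5_cycles e D.
Proof.
move=> tour strD D9 doutD; have D0 : D != set0 by rewrite -card_gt0; lia.
have [S [sSD S0 strS doutS minS]] := minimal_core D0 doutD.
have S7 := dout3_card tour S0 doutS.
case: (leqP #|S| 9) => [S9 | S10].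
  case: (strong_grow9 tour strD D9 strS sSD) => [|//|[H [sHD sSH strH H9]]].
    by rewrite S7.
  apply: (disjoint_4_5_cyclesS sHD); case: (eqVneq #|S| 9) => [eqS9 | neqS9].
    have eqSH : S = H by apply/eqP; rewrite eqEcard sSH eqS9 H9.
    have [u uS] := set0Pn _ S0; rewrite -eqSH.
    (* No vertex is defective here, so any [u] can play that part. *)
    by apply: (one_defect_cycles tour strS eqS9 uS) => [|x xS _]; rewrite ?doutS // ltnW ?doutS.
  by apply: core_cycles sSH _ doutS => //; lia.
apply: (disjoint_4_5_cyclesS sSD); apply: critical_core_cycles => // v vS.
have cardSv := cardsD1 v S; rewrite vS in cardSv.
case: (boolP [exists u in S, e u v && (dout e S u == 3)]) => [/exists_inP[u]|no].
  by exists u.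
(* If all in-neighbours of [v] had outdegree at least 4, [S :\ v] would be a smaller core. *)
have eqSv : S :\ v = S.
  apply: minS; first exact: subsetDl.
    by rewrite -card_gt0; lia.
  move=> x; rewrite !inE => /andP[_ xS]; have := doutD1 e x vS; have := doutS x xS.
  case exv: (e x v); last by lia.
  have : dout e S x != 3 by apply: contra no => ?; apply/exists_inP; exists x; rewrite ?exv.
  by lia.
by rewrite eqSv in cardSv; lia.
Qed.

(** * Three cycles *)

(** The set formed by [a], [u] and [s] is strong by [strong_return], hence has a spanning cycle. *)
Lemma return_cycle (T : finType) (e : rel T) a u s :
    tournament e -> uniq s -> 0 < size s -> e a u ->
    (forall y, y \in s -> e y a) -> (forall y, y \in s -> e u y) ->
  exists c, [/\ dcycle e c, size c = (size s).+2 & {subset c <= a :: u :: s}].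
Proof.
move=> tour uniq_s s_gt0 eau sa us.
have mems y : (y \in [set z in s]) = (y \in s) by rewrite inE.
have cards : #|[set z in s]| = size s by rewrite cardsE (card_uniqP uniq_s).
have strS : strong e (a |: (u |: [set z in s])).
  by apply: strong_return => // [|y|y]; rewrite ?mems -?card_gt0 ?cards //; auto.
have as_ : a \notin s by apply/negP=> /sa; rewrite (tournament_irr a tour).
have us_ : u \notin s by apply/negP=> /us; rewrite (tournament_irr u tour).
have cardS : #|a |: (u |: [set z in s])| = (size s).+2.
  rewrite !cardsU1 !inE negb_or as_ us_ (tournament_neq tour eau) /=.
  by rewrite cards.
have [|c [sz_c uniq_c cyc_c scS]] := strong_cycles tour strS (l := (size s).+2).
  by rewrite cardS leqnn andbT.
exists c; split=> //; first by split; rewrite ?sz_c.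
by move=> z /scS; rewrite !inE.
Qed.

Lemma pick_avoiding (T : finType) (A : {set T}) n (t : seq T) :
    n + size t <= #|A| ->
  exists s, [/\ uniq s, size s = n, {subset s <= A} & forall y, y \in s -> y \notin t].
Proof.
move=> leA; have /card_geqP[s [uniq_s sz_s sub_s]] : n <= #|A :\: [set y in t]|.
  rewrite cardsD; have := subset_leq_card (subsetIr A [set y in t]).
  by have : #|[set y in t]| <= size t by [rewrite cardsE card_size]; lia.
by exists s; split=> // y /sub_s; rewrite !inE => /andP[].
Qed.

(** Each [ai] is joined with one vertex of [U] and with [i] of its in-neighbours in [D], giving
    lengths 3, 4 and 5. Greedy disjoint choice explains the thresholds 1, 1 + 2, 1 + 2 + 3 in [D]
    and 1, 2, 3 in [U]. *)
Lemma linked_cycles (T : finType) (e : rel T) (D U : {set T}) a1 a2 a3 :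
    tournament e -> (forall u d, u \in U -> d \in D -> e u d) ->
    uniq [:: a1; a2; a3] ->
    (forall a, a \in [:: a1; a2; a3] -> a \notin D /\ a \notin U) ->
    1 <= #|[set d in D | e d a1]| -> 3 <= #|[set d in D | e d a2]| ->
    6 <= #|[set d in D | e d a3]| ->
    1 <= dout e U a1 -> 2 <= dout e U a2 -> 3 <= dout e U a3 ->
  three_disjoint_cycles_distinct_lengths e.
Proof.
move=> tour UD uniq_a aDU D1 D2 D3 U1 U2 U3.
have [s1 [uniq1 sz1 sub1 _]] := @pick_avoiding _ [set d in D | e d a1] 1 [::] D1.
have [|s2 [uniq2 sz2 sub2 avoid2]] := @pick_avoiding _ [set d in D | e d a2] 2 s1.
  by rewrite sz1.
have [|s3 [uniq3 sz3 sub3 avoid3]] := @pick_avoiding _ [set d in D | e d a3] 3 (s1 ++ s2).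
  by rewrite size_cat sz1 sz2.
have [u1] := card_gt0P U1; rewrite inE => /andP[u1U e1].
have [t2 [_ szt2 subu2 avoidu2]] := @pick_avoiding _ [set u in U | e a2 u] 1 [:: u1] U2.
case: t2 => [|u2 []] // in szt2 subu2 avoidu2 *.
have [t3 [_ szt3 subu3 avoidu3]] := @pick_avoiding _ [set u in U | e a3 u] 1 [:: u1; u2] U3.
case: t3 => [|u3 []] // in szt3 subu3 avoidu3 *.
have /andP[u2U e2] : (u2 \in U) && e a2 u2 by have := subu2 u2; rewrite !inE eqxx; apply.
have /andP[u3U e3] : (u3 \in U) && e a3 u3 by have := subu3 u3; rewrite !inE eqxx; apply.
have neq_u21 := avoidu2 u2 (mem_head _ _).
have neq_u3 := avoidu3 u3 (mem_head _ _).
rewrite !inE ?negb_or in neq_u21 neq_u3; case/andP: neq_u3 => neq_u31 neq_u32.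
have link a u s n : uniq s -> size s = n.+1 -> u \in U -> e a u ->
    {subset s <= [set d in D | e d a]} ->
  exists c, [/\ dcycle e c, size c = n.+3 & {subset c <= a :: u :: s}].
  move=> uniq_s sz_s uU eau sub_s; rewrite -sz_s; apply: return_cycle => // [|y|y].
  - by rewrite sz_s.
  - by move/sub_s; rewrite inE => /andP[].
  - by move/sub_s; rewrite inE => /andP[yD _]; apply: UD.
have [c1 [cyc1 szc1 subc1]] := link a1 u1 s1 0 uniq1 sz1 u1U e1 sub1.
have [c2 [cyc2 szc2 subc2]] := link a2 u2 s2 1 uniq2 sz2 u2U e2 sub2.
have [c3 [cyc3 szc3 subc3]] := link a3 u3 s3 2 uniq3 sz3 u3U e3 sub3.
have disj a u (s : seq T) a' u' (s' c c' : seq T) : a \in [:: a1; a2; a3] -> a' \in [:: a1; a2; a3] ->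
    a != a' -> u \in U -> u' \in U -> u' != u ->
    {subset s <= [set d in D | e d a]} -> {subset s' <= [set d in D | e d a']} ->
    (forall y, y \in s' -> y \notin s) ->
    {subset c <= a :: u :: s} -> {subset c' <= a' :: u' :: s'} -> [disjoint c & c'].
  move=> /aDU[aD aU] /aDU[a'D a'U] neq_a uU u'U neq_u ss ss' avoid sc sc'.
  have sD y : y \in s -> y \in D by move/ss; rewrite inE => /andP[].
  have s'D y : y \in s' -> y \in D by move/ss'; rewrite inE => /andP[].
  have UnD y : y \in U -> y \notin D.
    by move=> yU; apply/negP=> /(UD y y yU); rewrite (tournament_irr y tour).
  rewrite disjoint_sym disjoint_subset; apply/subsetP=> y /sc' yc'.
  rewrite inE; apply/negP=> /sc; move: yc'.
  rewrite !inE => /or3P[/eqP->|/eqP->|ys'] /or3P[].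
  - by rewrite eq_sym (negbTE neq_a).
  - by move/eqP=> a'u; rewrite a'u uU in a'U.
  - by move/sD; rewrite (negbTE a'D).
  - by move/eqP=> u'a; rewrite -u'a u'U in aU.
  - by rewrite (negbTE neq_u).
  - by move/sD; rewrite (negbTE (UnD _ u'U)).
  - by move/eqP=> ya; rewrite -ya (s'D y ys') in aD.
  - by move/eqP=> yu; have := UnD u uU; rewrite -yu (s'D y ys').
  - by rewrite (negbTE (avoid y ys')).
exists c1, c2, c3; split; rewrite ?szc1 ?szc2 ?szc3 //.
move: uniq_a; rewrite /= !inE !negb_or andbT => /andP[/andP[neq12 neq13] neq23].
have avoid31 y : y \in s3 -> y \notin s1.
  by move/avoid3; rewrite mem_cat negb_or => /andP[].
have avoid32 y : y \in s3 -> y \notin s2.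
  by move/avoid3; rewrite mem_cat negb_or => /andP[].
split.
- by apply: (disj a1 u1 s1 a2 u2 s2); rewrite ?inE ?eqxx ?orbT.
- by apply: (disj a1 u1 s1 a3 u3 s3); rewrite ?inE ?eqxx ?orbT.
- by apply: (disj a2 u2 s2 a3 u3 s3); rewrite ?inE ?eqxx ?orbT.
Qed.

Lemma dout_setID (T : finType) (e : rel T) (S A : {set T}) x :
  A \subset S -> dout e S x = dout e A x + dout e (S :\: A) x.
Proof.
by move=> sAS; rewrite /dout !card_sep_sum (big_setID A) /= (setIidPr sAS).
Qed.

Lemma dout_din_notin (T : finType) (e : rel T) (S : {set T}) x :
  tournament e -> x \notin S -> dout e S x + #|[set y in S | e y x]| = #|S|.
Proof.
move=> tour xS; rewrite /dout !card_sep_sum -big_split -sum1_card.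
apply: eq_bigr => y yS; rewrite /= (@tournament_sym _ _ x y) ?addn_negb //.
  by case: (e x y).
by apply: contraNneq xS => ->.
Qed.

Lemma min_outdeg6_cycles (T : finType) (e : rel T) :
    0 < #|T| -> tournament e -> min_outdeg_ge e 6 ->
  three_disjoint_cycles_distinct_lengths e.
Proof.
move=> T0 tour deg6.
have doutT x : 6 <= dout e setT x.
  by rewrite /dout; apply: leq_trans (deg6 x) _; apply/eq_leq/eq_card => y; rewrite !inE.
(* The terminal component of the whole tournament serves only to supply a triangle. *)
have [C [_ C0 strC clC]] : exists C : {set T}, [/\ C \subset setT, C != set0,
    strong e C & forall x y, x \in C -> y \in setT :\: C -> ~~ e x y].
  by apply: terminal_component; rewrite -card_gt0 cardsT.
have C7 : 7 <= #|C|.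
  apply: dout3_card tour C0 _ => x xC; rewrite (closed_dout (subsetT C) clC xC).
  exact: leq_trans (doutT x).
have [|x [y [z [_ [exy eyz ezx]]]]] := strong_triangle tour strC; first by lia.
have uniqA : uniq [:: x; y; z].
  by rewrite /= !inE negb_or (tournament_neq tour exy) (tournament_neq tour eyz)
             eq_sym (tournament_neq tour ezx).
pose A := [set w in [:: x; y; z]].
have cardA : #|A| = 3 by rewrite cardsE (card_uniqP uniqA).
have cyc3 : dcycle e [:: x; y; z] by split; rewrite //= exy eyz ezx.
pose R := setT :\: A.
have doutR v : dout e setT v = dout e A v + dout e R v by rewrite -dout_setID ?subsetT.
have leA v : dout e A v <= 3.
  by rewrite -cardA subset_leq_card //; apply/subsetP=> w; rewrite inE => /andP[].
have doutR3 v : 3 <= dout e R v by have := doutT v; rewrite doutR; have := leA v; lia.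
have R0 : R != set0.
  have /card_gt0P[w] : 0 < dout e R x by apply: leq_trans (doutR3 x).
  by rewrite inE => /andP[wR _]; apply/set0Pn; exists w.
have [D [sDR D0 strD clD]] := terminal_component e R0.
have doutD v : v \in D -> dout e D v = dout e R v by apply: closed_dout.
have doutD3 v : v \in D -> 3 <= dout e D v by move/doutD->.
have DnA v : v \in D -> v \notin A by move/(subsetP sDR); rewrite inE => /andP[].
have D7 := dout3_card tour D0 doutD3.
case: (leqP 9 #|D|) => [D9 | D8].
  have [c4 [c5 [sz4 sz5 uniq45 sub45 [cyc4 cyc5]]]] := strong_dout3_cycles tour strD D9 doutD3.
  move: uniq45; rewrite cat_uniq => /and3P[uniq4 no45 uniq5].
  have disjA (c : seq T) : {subset c <= c4 ++ c5} -> [disjoint [:: x; y; z] & c].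
    move=> sc; rewrite disjoint_sym disjoint_subset; apply/subsetP=> v.
    by move/sc/sub45/DnA; rewrite inE.
  exists [:: x; y; z], c4, c5; split; rewrite ?sz4 ?sz5 //.
  - by split; rewrite ?sz4.
  - by split; rewrite ?sz5.
  split; try by apply: disjA => v vc; rewrite mem_cat vc ?orbT.
  by rewrite disjoint_sym disjoint_has.
pose U := R :\: D.
have UD u d : u \in U -> d \in D -> e u d.
  move=> uU dD; rewrite (@tournament_sym _ _ d) ?clD //.
  by apply: contraTneq uU => <-; rewrite inE dD.
pose h a := #|[set d in D | e d a]|.
(* No arc goes from [D] to [U], so all six out-neighbours of a vertex of [D] lie in [D] or [A]. *)
have sumh : 6 * #|D| <= \sum_(d in D) dout e D d + \sum_(a in A) h a.
  have -> : \sum_(a in A) h a = \sum_(d in D) dout e A d by apply: sum_din_dout.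
  rewrite -big_split mulnC -sum_nat_const leq_sum // => d dD.
  by rewrite /= doutD // addnC -doutR.
have sumA : \sum_(a in A) h a = h x + (h y + h z).
  rewrite (eq_bigl (mem [:: x; y; z])) => [|a]; last by rewrite inE.
  by rewrite -big_uniq //= !big_cons big_nil addn0.
have predA a : a \in A -> exists2 b, b \in A & e b a.
  rewrite !inE => /or3P[] /eqP->; [exists z | exists x | exists y] => //;
  by rewrite !inE eqxx ?orbT.
have AnD a : a \in A -> a \notin D by apply: contraTN => /DnA.
have leh a : a \in A -> h a <= #|D|.
  by move/AnD/(dout_din_notin tour)=> <-; rewrite leq_addl.
(* The triangle gives [a] an in-neighbour in [A], so at most one of its out-neighbours is in [A];
   [#|D| - h a] of them are in [D]. *)
have doutU a : a \in A -> 5 + h a <= dout e U a + #|D|.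
  move=> aA; have [b bA eba] := predA a aA.
  have b_in : 0 < #|[set w in A | e w a]|.
    by apply/card_gt0P; exists b; rewrite inE bA.
  have cardD : dout e D a + h a = #|D| := dout_din_notin tour (AnD a aA).
  move: (dout_din tour aA) (doutT a) b_in cardD.
  by rewrite doutR (dout_setID e a sDR) cardA -/U; clear; lia.
have link a b c : perm_eq [:: x; y; z] [:: a; b; c] ->
    h a <= h b <= h c -> h a + (h b + h c) = h x + (h y + h z) ->
    three_disjoint_cycles_distinct_lengths e.
  move=> perm_abc leh_abc sum_abc.
  have memA w : w \in [:: a; b; c] -> w \in A by rewrite -(perm_mem perm_abc) [w \in A]inE.
  have [aA bA cA] : [/\ a \in A, b \in A & c \in A].
    by split; apply: memA; rewrite !inE eqxx ?orbT.
  (* At least 42 - 21 = 21 arcs go from [D] to [A] if [#|D| = 7], and 48 - 28 = 20 if [#|D| = 8],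
     while each [h] is at most [#|D|]. In the latter case [h a >= 20 - 16], [2 * h b >= 20 - 8] and
     [3 * h c >= 20]. *)
  have [ha hb hc] : [/\ 4 <= h a, 6 <= h b & 7 <= h c].
    move: (leh a aA) (leh b bA) (leh c cA) sumh sum_abc leh_abc.
    rewrite sumA; have : #|D| = 7 \/ #|D| = 8 by move: D7 D8; clear; lia.
    move=> D78; move: D78 (sum_dout D tour); clear=> -[->|->] *; split; lia.
  move: (doutU a aA) (doutU b bA) (doutU c cA) => Ua Ub Uc.
  apply: (linked_cycles tour UD (a1 := a) (a2 := b) (a3 := c)).
  - by rewrite -(perm_uniq perm_abc).
  - move=> w /memA wA; split; first exact: AnD.
    by rewrite 2!in_setD wA andbF.
  - exact: leq_trans ha.
  - exact: leq_trans hb.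
  - exact: leq_trans hc.
  - by move: Ua ha D8; clear; lia.
  - by move: Ub hb D8; clear; lia.
  - by move: Uc hc D8; clear; lia.
case: (leqP (h x) (h y)) (leqP (h y) (h z)) (leqP (h x) (h z)) => [xy|/ltnW yx] [yz|/ltnW zy] [xz|/ltnW zx].
- by apply: (link x y z); rewrite ?xy.
- by apply: (link x y z); rewrite ?xy.
- by apply: (link x z y); rewrite ?xz ?zy //; [apply/permP=> P /= | ]; clear; lia.
- by apply: (link z x y); rewrite ?zx ?xy //; [apply/permP=> P /= | ]; clear; lia.
- by apply: (link y x z); rewrite ?yx ?xz //; [apply/permP=> P /= | ]; clear; lia.
- by apply: (link y z x); rewrite ?yz ?zx //; [apply/permP=> P /= | ]; clear; lia.
- by apply: (link z y x); rewrite ?zy ?yx //; [apply/permP=> P /= | ]; clear; lia.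
- by apply: (link z y x); rewrite ?zy ?yx //; [apply/permP=> P /= | ]; clear; lia.
Qed.

(** * Sharpness of the bound *)

(** The rotational tournament on the integers modulo 11, with [i -> j] when [j - i] is one of 1 to
    5; adding 11 keeps the natural subtraction from truncating. *)
Definition rot11 : rel 'I_11 := fun i j => 0 < (j + 11 - i) %% 11 <= 5.

Lemma rot11_tournament : tournament rot11.
Proof.
split=> [x|x y neq_xy]; first by rewrite /rot11 addKn modnn.
have : x != y :> nat by [].
by rewrite /rot11; have := ltn_ord x; have := ltn_ord y; lia.
Qed.

Lemma rot11_outdeg x : outdeg rot11 x = 5.
Proof.
have -> : outdeg rot11 x = count (fun j => 0 < (j + 11 - x) %% 11 <= 5) (iota 0 11).
  rewrite /outdeg cardsE cardE /enum_mem size_filter -enumT -val_enum_ord count_map.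
  exact: eq_count.
have /allP all5 : all (fun i => count (fun j => 0 < (j + 11 - i) %% 11 <= 5)
    (iota 0 11) == 5) (iota 0 11) by [].
by apply/eqP/all5; rewrite mem_iota ltn_ord.
Qed.

Lemma dcycle_size_ge3 (T : finType) (e : rel T) c :
  tournament e -> dcycle e c -> 3 <= size c.
Proof.
move=> tour; case: c => [|x [|y [|z c]]] [] //= _ _.
  by rewrite (tournament_irr x tour).
by case/and3P=> exy eyx _; rewrite (tournament_asym tour exy) in eyx.
Qed.

(** Three different lengths, each at least 3, add up to at least 3 + 4 + 5 = 12. *)
Lemma no_three_cycles_lt12 (T : finType) (e : rel T) :
  tournament e -> #|T| < 12 -> ~ three_disjoint_cycles_distinct_lengths e.
Proof.
move=> tour T12 [c1 [c2 [c3 [cyc1 cyc2 cyc3 [d12 d13 d23] [n12 n13 n23]]]]].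
have := dcycle_size_ge3 tour cyc1; have := dcycle_size_ge3 tour cyc2.
have := dcycle_size_ge3 tour cyc3.
have : size (c1 ++ c2 ++ c3) <= #|T|.
  rewrite -(card_uniqP _) ?max_card // !cat_uniq.
  case: cyc1 cyc2 cyc3 => [_ -> _] [_ -> _] [_ -> _]; rewrite has_cat negb_or !andbT.
  by rewrite -!disjoint_has ![[disjoint _ & c1]]disjoint_sym d12 d13 disjoint_sym.
by rewrite !size_cat; lia.
Qed.

Theorem theorem1p3 :
  (forall (T : finType) (e : rel T),
      0 < #|T| -> tournament e -> min_outdeg_ge e 6 ->
      three_disjoint_cycles_distinct_lengths e) /\
  (exists (n : nat) (e : rel 'I_n),
      tournament e /\ min_outdeg_eq e 5 /\
      ~ three_disjoint_cycles_distinct_lengths e).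
Proof.
split; first exact: min_outdeg6_cycles.
exists 11, rot11; split; [exact: rot11_tournament | split].
  by split=> [x|]; [rewrite rot11_outdeg | exists ord0; rewrite rot11_outdeg].
by apply: no_three_cycles_lt12 rot11_tournament _; rewrite card_ord.
Qed.
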